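(* Let $f:(\mathbb{R}^2,0)\to(\mathbb{R}^3,0)$ be a map-germ such that $0$ is a cuspidal edge of $f$. Then there exist a diffeomorphism-germ $\varphi:(\mathbb{R}^2,0)\to(\mathbb{R}^2,0)$, an isometry-germ $\Phi:(\mathbb{R}^3,0)\to(\mathbb{R}^3,0)$, real numbers $a_{20},a_{30},b_{20},b_{30},b_{12},b_{03}$ with $b_{03}\neq 0$ and $b_{20}\ge 0$, and smooth functions $h_1(u),h_2(u),h_3(u),h_4(u),h_5(u,v)$ such that $$\Phi\circ f\circ\varphi(u,v)=\Big(u,\ \frac{a_{20}}{2}u^2+\frac{a_{30}}{6}u^3+\frac12 v^2,\ \frac{b_{20}}{2}u^2+\frac{b_{30}}{6}u^3+\frac{b_{12}}{2}uv^2+\frac{b_{03}}{6}v^3\Big)+h(u,v),$$ where $$h(u,v)=\big(0,\ u^4h_1(u),\ u^4h_2(u)+u^2v^2h_3(u)+uv^3h_4(u)+v^4h_5(u,v)\big).$$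
   Context: All maps and germs are $C^\infty$. Two map-germs $f_1,f_2:(\mathbb{R}^n,0)\to(\mathbb{R}^m,0)$ are $\mathcal{A}$-equivalent if there are diffeomorphism-germs $S:(\mathbb{R}^n,0)\to(\mathbb{R}^n,0)$ and $T:(\mathbb{R}^m,0)\to(\mathbb{R}^m,0)$ with $f_2\circ S=T\circ f_1$. A singular point $p$ of a map $f$ from a surface to $\mathbb{R}^3$ is a cuspidal edge if the germ of $f$ at $p$ is $\mathcal{A}$-equivalent to $(u,v)\mapsto(u,v^2,v^3)$ at $0$. Isometries of $\mathbb{R}^3$ are with respect to the Euclidean metric. *)

(* Defs.v *)
From HB Require Import structures.
From mathcomp Require Import all_boot all_order all_algebra.
From mathcomp Require Import all_classical all_reals all_analysis.

Set Implicit Arguments.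
Unset Strict Implicit.
Unset Printing Implicit Defensive.

Import Order.TTheory GRing.Theory Num.Theory.
Import numFieldNormedType.Exports.

Local Open Scope classical_set_scope.
Local Open Scope ring_scope.

(* A map-germ is represented by a total function; only its values near the
   base point matter, and equalities of germs are stated with [\near]. *)

(* [iter_derive [:: v1; ..; vk] f] is 'D_v1 (... ('D_vk f)). *)
Definition iter_derive (R : numFieldType) (V W : normedModType R)
    (s : seq V) (f : V -> W) : V -> W :=
  foldr (fun (v : V) (g : V -> W) => 'D_v g) f s.

(* C^oo near [a], for V and W finite-dimensional.  Since x |-> 'd f x is
   differentiable iff x |-> 'D_v f x = 'd f x v is for all v, asking that all
   iterated directional derivatives be Frechet-differentiable says that f is
   infinitely differentiable.  One neighbourhood serves for all orders. *)
Definition smooth_near (R : numFieldType) (V W : normedModType R)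
    (a : V) (f : V -> W) : Prop :=
  \forall x \near a, forall s : seq V, differentiable (iter_derive s f) x.

(* f : (R^n, 0) -> (R^m, 0) *)
Definition map_germ (R : realType) (n m : nat)
    (f : 'rV[R]_n -> 'rV[R]_m) : Prop :=
  f 0 = 0 /\ smooth_near 0 f.

Definition diffeo_germ (R : realType) (n : nat)
    (S : 'rV[R]_n -> 'rV[R]_n) : Prop :=
  map_germ S /\
  exists S' : 'rV[R]_n -> 'rV[R]_n,
    [/\ map_germ S',
        \forall x \near (0 : 'rV[R]_n), S' (S x) = x &
        \forall x \near (0 : 'rV[R]_n), S (S' x) = x].

Definition A_equivalent (R : realType) (n m : nat)
    (f1 f2 : 'rV[R]_n -> 'rV[R]_m) : Prop :=
  exists (S : 'rV[R]_n -> 'rV[R]_n) (T : 'rV[R]_m -> 'rV[R]_m),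
    [/\ diffeo_germ S, diffeo_germ T &
        \forall x \near (0 : 'rV[R]_n), f2 (S x) = T (f1 x)].

Definition vec3 (R : realType) (a b c : R) : 'rV[R]_3 :=
  \row_(j < 3) [:: a; b; c]`_j.

Definition standard_cuspidal_edge (R : realType) (x : 'rV[R]_2) : 'rV[R]_3 :=
  let u := x 0 0 in let v := x 0 1 in vec3 u (v ^+ 2) (v ^+ 3).

Definition singular_at (R : realType) (f : 'rV[R]_2 -> 'rV[R]_3)
    (p : 'rV[R]_2) : Prop :=
  (\rank ('J f p) < 2)%N.

Definition cuspidal_edge_at0 (R : realType) (f : 'rV[R]_2 -> 'rV[R]_3) : Prop :=
  singular_at f 0 /\ A_equivalent f (@standard_cuspidal_edge R).

(* The library norm on matrices is the sup norm, hence this definition. *)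
Definition euclidean_dist (R : realType) (n : nat) (x y : 'rV[R]_n) : R :=
  Num.sqrt (\sum_(i < n) (x 0 i - y 0 i) ^+ 2).

Definition isometry (R : realType) (n : nat)
    (Phi : 'rV[R]_n -> 'rV[R]_n) : Prop :=
  bijective Phi /\ forall x y, euclidean_dist (Phi x) (Phi y) = euclidean_dist x y.

Definition isometry_germ (R : realType) (n : nat)
    (Phi : 'rV[R]_n -> 'rV[R]_n) : Prop :=
  isometry Phi /\ Phi 0 = 0.

(* Main.v *)
Require Import Defs.
From HB Require Import structures.
From mathcomp Require Import all_boot all_order all_algebra.
From mathcomp Require Import all_classical all_reals all_analysis.
From mathcomp Require Import ring lra.

Set Implicit Arguments.
Unset Strict Implicit.
Unset Printing Implicit Defensive.

Import Order.TTheory GRing.Theory Num.Theory.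
Import numFieldNormedType.Exports.

Local Open Scope classical_set_scope.
Local Open Scope ring_scope.

(* Write f = G o cusp o S near 0, with cusp (u, v) = (u, v^2, v^3) and G a
   diffeomorphism germ of R^3.  After a rotation given by Gram-Schmidt, the
   Jacobian of G at 0 is triangular with nonzero diagonal.  Solving
   G_1 (a, y, z) = u for a makes the first component equal to u and keeps the
   other two of the form B (u, v^2, v^3) and C (u, v^2, v^3).  By Hadamard's
   lemma B (u, v^2, v^3) = B (u, 0, 0) + v^2 q (u, v) with q (0, 0) > 0, so that
   V = v * sqrt (2 q) is a coordinate; then v = V * w (u, V), and expanding
   C (u, V^2 w^2, V^3 w^3) in powers of V, then its coefficients in powers of u,
   gives the normal form.  There is no term in V, the coefficient of V^2
   vanishes at u = 0 since dC/dy = 0 at 0, and that of V^3 does not since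
   dC/dz <> 0.  A reflection of the last axis makes b20 nonnegative. *)

(** * C^k calculus on open sets *)

(** Both changes of source coordinates alter one coordinate and keep the other as a parameter, so an
    implicit function theorem for one unknown replaces the inverse function theorem; the inverse of
    the target diffeomorphism comes with A-equivalence. Replacing u commutes with (u, v) |-> (u,
    v^2, v^3), so the first change can be solved on R^3 and pulled back. Working with functions on
    R^3 evaluated on the cusp also makes the absence of a term linear in v automatic, and division
    by y and by z yields smooth coefficients of v^2 and v^3. The first two diagonal entries of the
    frame must be positive, one for monotonicity in the unknown and the other under the square root;
    the sign of the third is left free, so the last axis may still be reflected. The remainders h_i
    have to be smooth, so the expansions rest on Hadamard's integral formula instead of Taylor's
    formula with an intermediate point; hence the calculus of integrals depending on a parameter. *)

Section Ck.
Variable R : realType.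
Implicit Types V W : normedModType R.

(** The index counts derivatives that are themselves differentiable, so [Ck 0] is plain
    differentiability. Recursion on [k] lets the product and chain rules be proved by induction,
    which the lists of [iter_derive] do not directly allow. *)
Fixpoint Ck V W (k : nat) (U : set V) (f : V -> W) : Prop :=
  (forall x, U x -> differentiable f x) /\
  if k is k'.+1 then forall v, Ck k' U ('D_v f) else True.

Lemma Ck_differentiable V W k (U : set V) (f : V -> W) x :
  Ck k U f -> U x -> differentiable f x.
Proof. by case: k => [|k] [+ _]; apply. Qed.

Lemma CkS V W k (U : set V) (f : V -> W) : Ck k.+1 U f -> Ck k U f.
Proof.
elim: k f => [|k IH] f [df Df]; first by split.
by split=> // v; apply: IH; apply: Df.
Qed.

Lemma Ck_subset V W k (U U' : set V) (f : V -> W) :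
  U' `<=` U -> Ck k U f -> Ck k U' f.
Proof.
move=> UU; elim: k f => [|k IH] f [df Df]; (split; first by move=> x /UU/df) => //.
by move=> v; apply: IH; exact: Df.
Qed.

Lemma near_eq_differentiable V W (f g : V -> W) (a : V) :
  (\near a, f a = g a) -> differentiable f a -> differentiable g a.
Proof.
move=> fg /diff_locallyP [cf ef]; apply/diff_locallyP.
(* The first-order expansion depends only on the germ, so the differential of [f] serves for [g];
   uniqueness then identifies it. *)
have eg : g \o shift a = cst (g a) + 'd f a +o_ 0 id.
  apply/eqaddoP => e e0; have := ef => /eqaddoP/(_ e e0).
  have fg0 : \forall h \near (0 : V), f (h + a) = g (h + a).
    by move: fg; rewrite (near_shift 0) /=; apply: filterS => h; rewrite subr0.
  rewrite !near_simpl; apply: filter_app; near=> h.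
  rewrite /= !fctE /= -(nbhs_singleton fg) (near fg0 h) //.
have -> := diff_unique cf eg; split => //.
Unshelve. all: by end_near. Qed.

Lemma Ck_eq V W k (U : set V) (f g : V -> W) : open U ->
  (forall x, U x -> f x = g x) -> Ck k U f -> Ck k U g.
Proof.
move=> oU; have nU x : U x -> \forall y \near x, U y by move=> Ux; exact: open_nbhs_nbhs.
have H (h h' : V -> W) x : (forall x, U x -> h x = h' x) -> U x ->
  \near x, h x = h' x by move=> hh' Ux; apply: filterS (nU x Ux).
elim: k f g => [|k IH] f g fg [df Df];
  (split; first by move=> x Ux; apply: near_eq_differentiable (df _ Ux); exact: H) => //.
by move=> v; apply: IH (Df v) => x Ux; apply: near_eq_derive; exact: H.
Qed.

(** The derivative taken first stands last in the list, while [Ck] peels it off first; hence the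
    inductions go through [rcons]. *)
Lemma iter_derive_Ck V W (U : set V) (f : V -> W) :
  (forall x, U x -> forall s, differentiable (iter_derive s f) x) <->
  forall k, Ck k U f.
Proof.
split=> [+ k|+ x Ux s].
  elim: k f => [|k IH] f H; (split; first by move=> x Ux; exact: (H _ Ux [::])) => // v.
  apply: IH => x Ux s; have := H x Ux (rcons s v).
  by rewrite /iter_derive foldr_rcons.
elim/last_ind: s f => [|s v IH] f H; first exact: (Ck_differentiable (H 0%N)).
rewrite /iter_derive foldr_rcons; apply: IH => k.
by have [_] := H k.+1; apply.
Qed.

Lemma smooth_nearP V W (a : V) (f : V -> W) :
  smooth_near a f <->
  exists U : set V, [/\ open U, U a & forall k, Ck k U f].
Proof.
rewrite /smooth_near; split.
  move=> H; exists (interior [set x | forall s, differentiable (iter_derive s f) x]).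
  by split; [exact: open_interior|exact: H|apply/iter_derive_Ck => x /interior_subset].
move=> [U [oU Ua /iter_derive_Ck H]].
by apply: filterS (open_nbhs_nbhs (conj oU Ua)).
Qed.

Lemma Ck_cst V W k (U : set V) (c : W) : Ck k U (cst c : V -> W).
Proof.
elim: k c => [|k IH] c; split=> // v.
have -> : 'D_v (cst c : V -> W) = cst 0; last exact: IH.
by apply/funext => x; rewrite derive_cst.
Qed.

Lemma Ck_linear V W k (U : set V) (f : {linear V -> W}) : continuous f ->
  Ck k U f.
Proof.
move=> cf; case: k => [|k]; (split; first by move=> *; exact: linear_differentiable) => // v.
 have -> : 'D_v f = cst (f v); last exact: Ck_cst.
by apply/funext => x; rewrite deriveE ?diff_lin//; exact: linear_differentiable.
Qed.

Lemma Ck_is_linear V k (D : set V) (f : V -> R) :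
  linear f -> continuous f -> Ck k D f.
Proof.
move=> lf cf; pose fM := GRing.isLinear.Build _ _ _ _ _ lf.
pose fL : {linear V -> R} := HB.pack f fM.
exact: (@Ck_linear V _ k D fL).
Qed.

Lemma Ck_id k (U : set R) : Ck k U (fun x : R => x).
Proof. by apply: Ck_is_linear => // x; exact: cvg_id. Qed.

Lemma Ck_coord n k (U : set 'rV[R]_n) i : Ck k U (fun x : 'rV[R]_n => x 0 i).
Proof.
by apply: Ck_is_linear => [a x y|]; [rewrite !mxE|exact: coord_continuous].
Qed.

Lemma CkD V W k (U : set V) (f g : V -> W) : open U ->
  Ck k U f -> Ck k U g -> Ck k U (fun x => f x + g x).
Proof.
move=> oU; elim: k f g => [|k IH] f g [df Df] [dg Dg]; 
  (split; first by move=> x Ux; apply: differentiableD; [exact: df|exact: dg]) => // v.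
apply: Ck_eq (IH _ _ (Df v) (Dg v)) => // x Ux.
by rewrite -deriveD //; apply: diff_derivable; [exact: df|exact: dg].
Qed.

(** The Leibniz rule keeps one factor undifferentiated; [CkS] lowers its order so that the induction
    hypothesis applies. *)
Lemma CkM V k (U : set V) (f g : V -> R) : open U ->
  Ck k U f -> Ck k U g -> Ck k U (fun x => f x * g x).
Proof.
move=> oU; elim: k f g => [|k IH] f g Hf Hg.
  have [[df Df] [dg Dg]] := (Hf, Hg); split=> // x Ux.
  by apply: differentiableM; [exact: df|exact: dg].
have [[df Df] [dg Dg]] := (Hf, Hg); split=> [x Ux|v].
  by apply: differentiableM; [exact: df|exact: dg].
apply: Ck_eq (CkD oU (IH _ _ (CkS Hf) (Dg v)) (IH _ _ (CkS Hg) (Df v))) => //.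
move=> x Ux; rewrite -deriveM //; apply: diff_derivable; [exact: df|exact: dg].
Qed.

Lemma differentiable_rowP V n (g : V -> 'rV[R]_n) x :
  (forall j, differentiable (fun y => g y 0 j) x) <-> differentiable g x.
Proof.
split=> [dg|dg j]; last first.
  exact: (differentiable_comp dg (differentiable_coord _ _ _)).
have -> : g = \sum_j (fun y => g y 0 j *: (delta_mx 0 j : 'rV[R]_n)).
  by apply/funext => y; rewrite fct_sumE -row_sum_delta.
by apply: differentiable_sum => j; exact: differentiableZl.
Qed.

Lemma derive_row V n (g : V -> 'rV[R]_n) x v j : differentiable g x ->
  ('D_v g x) 0 j = 'D_v (fun y => g y 0 j) x.
Proof. by move=> dg; rewrite derive_mx ?mxE //; exact: diff_derivable. Qed.

(** The chain rule is put as a sum of products of scalar functions, the form on which induction over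
    the order closes. *)
Lemma derive_comp_row V n (f : 'rV[R]_n -> R) (g : V -> 'rV[R]_n) x v :
  differentiable f (g x) -> differentiable g x ->
  'D_v (fun y => f (g y)) x =
  \sum_j 'D_v (fun y => g y 0 j) x * 'D_(delta_mx 0 j) f (g x).
Proof.
move=> df dg; rewrite deriveE; last exact: differentiable_comp.
rewrite diff_comp //= -(deriveE v dg) [in LHS](row_sum_delta ('D_v g x)) linear_sum.
by apply: eq_bigr => j _; rewrite linearZ /= derive_row // [in RHS](deriveE _ df).
Qed.

Lemma Ck_sum V k (U : set V) n (f : 'I_n -> V -> R) : open U ->
  (forall j, Ck k U (f j)) -> Ck k U (fun x => \sum_j f j x).
Proof.
move=> oU; elim: n f => [|n IH] f Hf.
  apply: Ck_eq (Ck_cst k U 0) => // x Ux; by rewrite big_ord0.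
apply: Ck_eq (CkD oU (IH _ (fun j => Hf (widen_ord (leqnSn n) j))) (Hf ord_max)) => //.
by move=> x _; rewrite big_ord_recr.
Qed.

Lemma Ck_comp V n k (D : set V) (U : set 'rV[R]_n) (f : 'rV[R]_n -> R)
    (g : V -> 'rV[R]_n) : open D -> (forall x, D x -> U (g x)) ->
  Ck k U f -> (forall j, Ck k D (fun x => g x 0 j)) ->
  Ck k D (fun x => f (g x)).
Proof.
move=> oD DU; elim: k f => [|k IH] f Hf Hg;
  have dg x : D x -> differentiable g x by
    move=> Dx; apply/differentiable_rowP => j; exact: Ck_differentiable (Hg j) Dx.
  split=> // x Dx; apply: differentiable_comp; first exact: dg.
  by apply: Ck_differentiable Hf _; exact: DU.
split=> [x Dx|v].
  apply: differentiable_comp; first exact: dg.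
  by apply: Ck_differentiable Hf _; exact: DU.
have := @Ck_sum V k D n (fun j x => 'D_v (fun y => g y 0 j) x * 'D_(delta_mx 0 j) f (g x)) oD.
move=> H; apply: Ck_eq (H _) => //= {H}.
- move=> x Dx; rewrite derive_comp_row //; last exact: dg.
  by apply: Ck_differentiable Hf _; exact: DU.
move=> j; apply: CkM => //; first by have [_] := Hg j; apply.
by apply: (IH ('D_(delta_mx 0 j) f)) => [|i]; [have [_] := Hf; apply | apply: CkS; exact: Hg].
Qed.

(** Separate from [Ck_comp] because [R] and ['rV[R]_1] are different types. *)
Lemma Ck_comp1 V k (D : set V) (U : set R) (f : R -> R) (g : V -> R) :
  open D -> (forall x, D x -> U (g x)) ->
  Ck k U f -> Ck k D g -> Ck k D (fun x => f (g x)).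
Proof.
move=> oD DU; elim: k f => [|k IH] f Hf Hg;
  have dg x : D x -> differentiable g x by exact: Ck_differentiable Hg.
  split=> // x Dx; apply: differentiable_comp; first exact: dg.
  by apply: Ck_differentiable Hf _; exact: DU.
have df x : D x -> differentiable f (g x).
  by move=> Dx; apply: Ck_differentiable Hf _; exact: DU.
split=> [x Dx|v]; first by apply: differentiable_comp; [exact: dg|exact: df].
have H : Ck k D (fun x => 'D_v g x * 'D_1 f (g x)).
  apply: CkM => //; first by have [_] := Hg; apply.
  by apply: (IH ('D_1 f)); [have [_] := Hf; apply|exact: CkS].
apply: Ck_eq H => // x Dx.
rewrite [RHS]deriveE; last by apply: differentiable_comp; [exact: dg|exact: df].
rewrite (diff_comp (dg x Dx) (df x Dx)) /= (diff1E (df x Dx)) derive1E.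
by rewrite -(deriveE _ (dg x Dx)).
Qed.

Lemma Ck_rowP V n k (U : set V) (f : V -> 'rV[R]_n) : open U ->
  (forall j, Ck k U (fun x => f x 0 j)) <-> Ck k U f.
Proof.
move=> oU; elim: k f => [|k IH] f.
  split=> [H|[H _] j]; split=> // x Ux; first apply/differentiable_rowP => j.
    by have [+ _] := H j; apply.
  by have /differentiable_rowP := H _ Ux.
have E v x j : differentiable f x -> 'D_v (fun y => f y 0 j) x = ('D_v f x) 0 j.
  by move=> df; rewrite derive_row.
split=> [H|[df Df] j].
  have df x : U x -> differentiable f x.
    by move=> Ux; apply/differentiable_rowP => j; have [+ _] := H j; apply.
  split=> // v; apply/IH => j.
  have [_ /(_ v)] := H j; apply: Ck_eq => // x Ux; exact/E/df.
split=> [x Ux|v]; first by have /differentiable_rowP := df _ Ux.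
have /IH/(_ j) := Df v; apply: Ck_eq => // x Ux; exact/esym/E/df.
Qed.

(** The derivative - f' / f^2 involves f^-1 only at the lower order, where the induction hypothesis
    covers it. *)
Lemma CkV V k (U : set V) (f : V -> R) : open U ->
  (forall x, U x -> f x != 0) -> Ck k U f -> Ck k U (fun x => (f x)^-1).
Proof.
move=> oU f0; elim: k => [|k IH] Hf.
  split=> // x Ux; apply: differentiableV; last exact: f0.
  exact: Ck_differentiable Hf Ux.
split=> [x Ux|v].
  by apply: differentiableV; [exact: Ck_differentiable Hf Ux|exact: f0].
have IHf := IH (CkS Hf).
have Hm : Ck k U (fun x => -1 * ((f x)^-1 * (f x)^-1) * 'D_v f x).
  apply: CkM => //; last by have [_] := Hf; apply.
  apply: CkM => //; first exact: (Ck_cst k U (-1 : R)).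
  exact: CkM.
apply: Ck_eq Hm => // x Ux; rewrite deriveV //; last 2 first.
- exact: f0.
- by apply: diff_derivable; exact: Ck_differentiable Hf Ux.
by rewrite mulN1r expr2 invfM.
Qed.

(** Same induction as for the inverse: the derivative f' / (2 sqrt f) involves sqrt f only at the
    lower order. *)
Lemma Ck_sqrt V k (U : set V) (f : V -> R) : open U ->
  (forall x, U x -> 0 < f x) -> Ck k U f -> Ck k U (fun x => Num.sqrt (f x)).
Proof.
move=> oU f0.
have d0 x : U x -> differentiable f x -> differentiable (fun x => Num.sqrt (f x)) x.
  move=> Ux df; apply: (differentiable_comp df).
  apply/derivable1_diffP.
  by have [] := is_derive1_sqrt (f0 x Ux).
elim: k => [|k IH] Hf.
  by split=> // x Ux; apply: d0 => //; exact: Ck_differentiable Hf Ux.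
split=> [x Ux|v].
  by apply: d0 => //; exact: Ck_differentiable Hf Ux.
have IHf := IH (CkS Hf).
have Hm : Ck k U (fun x => (2 * Num.sqrt (f x))^-1 * 'D_v f x).
  apply: CkM => //; last by have [_] := Hf; apply.
  apply: CkV => //.
    by move=> x Ux; rewrite mulf_neq0 // ?pnatr_eq0// sqrtr_eq0 -ltNge f0.
  by apply: CkM => //; exact: Ck_cst.
apply: Ck_eq Hm => // x Ux.
have df : differentiable f x by exact: Ck_differentiable Hf Ux.
have dsf := is_derive1_sqrt (f0 x Ux).
have ds : differentiable (Num.sqrt : R -> R) (f x).
  by apply/derivable1_diffP; case: dsf.
rewrite [RHS]deriveE; last exact: d0.
rewrite (diff_comp df ds) /= (diff1E ds) derive1E derive_val -(deriveE _ df).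
exact: mulrC.
Qed.

End Ck.

(** * Germs of smooth functions *)

Section smooth_near.
Variable R : realType.
Implicit Types V W : normedModType R.

Lemma smooth_near_differentiable V W (a : V) (f : V -> W) :
  smooth_near a f -> differentiable f a.
Proof. by move=> /smooth_nearP[U [_ Ua /(_ 0%N)/Ck_differentiable]]; apply. Qed.

Lemma smooth_near_continuous V W (a : V) (f : V -> W) :
  smooth_near a f -> {for a, continuous f}.
Proof. by move=> /smooth_near_differentiable; exact: differentiable_continuous. Qed.

Lemma smooth_near_cst V W (a : V) (c : W) : smooth_near a (fun _ : V => c).
Proof. by apply/smooth_nearP; exists setT; split=> // [|k]; [exact: openT|exact: Ck_cst]. Qed.

Lemma smooth_near_id (a : R) : smooth_near a (fun x : R => x).
Proof. by apply/smooth_nearP; exists setT; split=> // [|k]; [exact: openT|exact: Ck_id]. Qed.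

Lemma smooth_near_coord n (a : 'rV[R]_n) i : smooth_near a (fun x : 'rV[R]_n => x 0 i).
Proof. by apply/smooth_nearP; exists setT; split=> // [|k]; [exact: openT|exact: Ck_coord]. Qed.

Lemma smooth_nearD V W (a : V) (f g : V -> W) : smooth_near a f ->
  smooth_near a g -> smooth_near a (fun x => f x + g x).
Proof.
move=> /smooth_nearP[U [oU Ua Uf]] /smooth_nearP[U' [oU' U'a Ug]].
apply/smooth_nearP; exists (U `&` U'); split=> //; first exact: openI.
move=> k; apply: CkD; first exact: openI.
- by apply: Ck_subset (Uf k) => x [].
- by apply: Ck_subset (Ug k) => x [].
Qed.

Lemma smooth_nearM V (a : V) (f g : V -> R) : smooth_near a f ->
  smooth_near a g -> smooth_near a (fun x => f x * g x).
Proof.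
move=> /smooth_nearP[U [oU Ua Uf]] /smooth_nearP[U' [oU' U'a Ug]].
apply/smooth_nearP; exists (U `&` U'); split=> //; first exact: openI.
move=> k; apply: CkM; first exact: openI.
- by apply: Ck_subset (Uf k) => x [].
- by apply: Ck_subset (Ug k) => x [].
Qed.

Lemma smooth_nearX V (a : V) (f : V -> R) n : smooth_near a f ->
  smooth_near a (fun x => f x ^+ n).
Proof.
move=> sf; elim: n => [|n IH]; first exact: (smooth_near_cst a (1 : R)).
by under eq_fun do rewrite exprS; exact: smooth_nearM.
Qed.

Lemma smooth_nearN V (a : V) (f : V -> R) : smooth_near a f ->
  smooth_near a (fun x => - f x).
Proof.
move=> sf; under eq_fun do rewrite -mulN1r.
by apply: smooth_nearM => //; exact: smooth_near_cst.
Qed.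

Lemma smooth_near_sum V n (a : V) (f : 'I_n -> V -> R) :
  (forall i, smooth_near a (f i)) -> smooth_near a (fun x => \sum_i f i x).
Proof.
elim: n f => [|n IH] f Hf.
  by under eq_fun do rewrite big_ord0; exact: (smooth_near_cst a (0 : R)).
under eq_fun do rewrite big_ord_recr.
by apply: smooth_nearD => //; apply: IH.
Qed.

Lemma smooth_near_open V W (a : V) (f : V -> W) (P : set W) :
  open P -> P (f a) -> smooth_near a f ->
  exists U : set V, [/\ open U, U a, forall k, Ck k U f & forall x, U x -> P (f x)].
Proof.
move=> oP Pfa sf; have := sf => /smooth_nearP[U [oU Ua Uf]].
exists (U `&` (f @^-1` P)°); split.
- by apply: openI => //; exact: open_interior.
- by split=> //; apply: (smooth_near_continuous sf); exact: open_nbhs_nbhs.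
- by move=> k; apply: Ck_subset (Uf k) => x [].
- by move=> x [_ /interior_subset].
Qed.

Lemma smooth_nearV V (a : V) (f : V -> R) : smooth_near a f -> f a != 0 ->
  smooth_near a (fun x => (f x)^-1).
Proof.
move=> sf fa; have [U [oU Ua Uf Uf0]] := smooth_near_open (@open_neq R 0) fa sf.
apply/smooth_nearP; exists U; split=> // k.
exact: CkV.
Qed.

Lemma smooth_near_sqrt V (a : V) (f : V -> R) : smooth_near a f -> 0 < f a ->
  smooth_near a (fun x => Num.sqrt (f x)).
Proof.
move=> sf fa; have [U [oU Ua Uf Uf0]] := smooth_near_open (@open_gt R 0) fa sf.
apply/smooth_nearP; exists U; split=> // k.
exact: Ck_sqrt.
Qed.

Lemma smooth_near_rowP V n (a : V) (f : V -> 'rV[R]_n) :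
  (forall j, smooth_near a (fun x => f x 0 j)) <-> smooth_near a f.
Proof.
split=> [H|/smooth_nearP[U [oU Ua Uf]] j]; last first.
  by apply/smooth_nearP; exists U; split=> // k; apply: (Ck_rowP k f oU).2.
have /choice[U HU] : forall j, exists U : set V,
    [/\ open U, U a & forall k, Ck k U (fun x => f x 0 j)].
  by move=> j; apply/smooth_nearP.
(* There are finitely many coordinates, so the intersection is still a neighbourhood of [a]. *)
have oB : open (\bigcap_j U j)° by exact: open_interior.
apply/smooth_nearP; exists (\bigcap_j U j)°; split=> //.
  have : \forall x \near a, forall j, U j x.
    by apply: filter_forall => j; have [oU Ua _] := HU j; exact: open_nbhs_nbhs.
  by apply: filterS => x Hx j _.
move=> k; apply/Ck_rowP => // j; have [_ _ /(_ k)] := HU j.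
by apply: Ck_subset => x /interior_subset; apply.
Qed.

Lemma smooth_near_comp V n (a : V) (f : 'rV[R]_n -> R) (g : V -> 'rV[R]_n) :
  smooth_near (g a) f -> smooth_near a g -> smooth_near a (fun x => f (g x)).
Proof.
move=> /smooth_nearP[P [oP Pfa Pf]] /(smooth_near_open oP Pfa)[U [oU Ua Ug UP]].
apply/smooth_nearP; exists U; split=> // k.
by apply: (Ck_comp (U := P)) => //; apply/Ck_rowP.
Qed.

Lemma smooth_near_comp1 V (a : V) (f : R -> R) (g : V -> R) :
  smooth_near (g a) f -> smooth_near a g -> smooth_near a (fun x => f (g x)).
Proof.
move=> /smooth_nearP[P [oP Pfa Pf]] /(smooth_near_open oP Pfa)[U [oU Ua Ug UP]].
by apply/smooth_nearP; exists U; split=> // k; exact: (Ck_comp1 (U := P)).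
Qed.

Lemma smooth_near_comp_row V m n (a : V) (f : 'rV[R]_n -> 'rV[R]_m)
    (g : V -> 'rV[R]_n) :
  smooth_near (g a) f -> smooth_near a g -> smooth_near a (fun x => f (g x)).
Proof.
move=> /smooth_near_rowP sf sg; apply/smooth_near_rowP => j.
exact: (smooth_near_comp (sf j)).
Qed.

End smooth_near.

(** * Integrals depending on a parameter *)

Section parametric_integral.
Variable R : realType.

Lemma norm_coord n (h : 'rV[R]_n) j : `|h 0 j| <= `|h|.
Proof. by rewrite [leRHS]mx_normrE; exact: (le_bigmax _ (fun ij => `|h ij.1 ij.2|) (0, j)). Qed.

(** An epsilon criterion in place of little-o notation; through [differentiable_rV] it yields both
    differentiation under the integral and differentiability of implicit functions. *)
Lemma differentiable_bound (V W : normedModType R) (f : V -> W) (x : V)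
    (L : {linear V -> W}) : continuous L ->
  (forall e, 0 < e -> \forall h \near (0 : V),
     `|f (h + x) - f x - L h| <= e * `|h|) ->
  differentiable f x /\ forall v, 'D_v f x = L v.
Proof.
move=> cL H.
have eL : f \o shift x = cst (f x) + L +o_ 0 id.
  apply/eqaddoP => e e0; have := H e e0; rewrite !near_simpl.
  by apply: filterS => h; rewrite /= !fctE /= opprD addrA.
have dL := diff_unique cL eL.
have df : differentiable f x by apply/diff_locallyP; rewrite dL.
by split=> // v; rewrite deriveE // dL.
Qed.

Lemma differentiable_rV n (f : 'rV[R]_n -> R) (x : 'rV[R]_n) (c : 'I_n -> R) :
  (forall e, 0 < e -> \forall h \near (0 : 'rV[R]_n),
     `|f (h + x) - f x - \sum_j h 0 j * c j| <= e * `|h|) ->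
  differentiable f x /\ forall v, 'D_v f x = \sum_j v 0 j * c j.
Proof.
move=> H.
pose L0 (h : 'rV[R]_n) : R := \sum_j h 0 j * c j.
have linL : linear L0.
  move=> a u v; rewrite /L0 scaler_sumr -big_split; apply: eq_bigr => j _ /=.
  by rewrite !mxE mulrDl -scalerAl.
pose LM := GRing.isLinear.Build _ _ _ _ _ linL.
pose L : {linear 'rV[R]_n -> R} := HB.pack L0 LM.
have cL : continuous L.
  move=> y; apply: differentiable_continuous.
  have -> : (L : 'rV[R]_n -> R) = \sum_j (fun h : 'rV[R]_n => h 0 j * c j).
    by apply/funext => h; rewrite fct_sumE.
  apply: differentiable_sum => j; apply: differentiableM => //.
  exact: differentiable_coord.
exact: (differentiable_bound cL).
Qed.

Local Notation mu := (@lebesgue_measure R).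

Lemma continuous_integrable01 (f : R -> R) :
  (forall t, t \in `[0, 1]%R -> {for t, continuous f}) ->
  mu.-integrable `[0, 1] (EFin \o f).
Proof.
move=> cf; apply: continuous_compact_integrable; first exact: segment_compact.
by apply: continuous_in_subspaceT => t; rewrite inE; exact: cf.
Qed.

Lemma normr_Rintegral01_le (f : R -> R) (M : R) :
  (forall t, t \in `[0, 1]%R -> {for t, continuous f}) ->
  (forall t, t \in `[0, 1]%R -> `|f t| <= M) ->
  `|\int[mu]_(t in `[0, 1]) f t| <= M.
Proof.
move=> cf fM; have intf := continuous_integrable01 cf.
apply: (le_trans (le_normr_Rintegral _ intf)) => //.
have -> : M = \int[mu]_(t in `[0, 1]) M.
  rewrite Rintegral_cst //= lebesgue_measure_itv /= lte01 /=.
  by rewrite oppr0 addr0 mulr1.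
apply: le_Rintegral => //.
- apply: continuous_integrable01 => t t01.
  by apply: continuous_comp; [exact: cf|exact: norm_continuous].
- by apply: continuous_integrable01 => t t01; exact: cvg_cst.
Qed.

Lemma continuous_at_sum (T : topologicalType) m (f : 'I_m -> T -> R) (t : T) :
  (forall j, {for t, continuous (f j)}) ->
  {for t, continuous (fun t => \sum_j f j t)}.
Proof.
elim: m f => [|m IH] f cf; rewrite /prop_for /continuous_at.
  by under eq_fun do rewrite big_ord0; rewrite big_ord0; exact: cvg_cst.
under eq_fun do rewrite big_ord_recr /=; rewrite big_ord_recr /=.
by apply: cvgD; [apply: IH => j|]; exact: cf.
Qed.

Lemma Rintegral01_sum m (w : 'I_m -> R) (f : 'I_m -> R -> R) :
  (forall j t, t \in `[0, 1]%R -> {for t, continuous (f j)}) ->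
  \int[mu]_(t in `[0, 1]) (\sum_j w j * f j t) =
  \sum_j w j * \int[mu]_(t in `[0, 1]) f j t.
Proof.
elim: m w f => [|m IH] w f cf.
  rewrite big_ord0; under eq_Rintegral do rewrite big_ord0.
  by rewrite Rintegral_cst // mul0r.
have cwf j t : t \in `[0, 1]%R -> {for t, continuous (fun t => w j * f j t)}.
  by move=> t01; apply: continuousM; [exact: cvg_cst|exact: cf].
rewrite big_ord_recr /=; under eq_Rintegral do rewrite big_ord_recr /=.
rewrite RintegralD //=.
- rewrite IH; last by move=> j t; exact: cf.
  by rewrite RintegralZl //; apply: continuous_integrable01 => t; exact: cf.
- apply: continuous_integrable01 => t t01; apply: continuous_at_sum => j.
  exact: cwf.
- by apply: continuous_integrable01 => t t01; exact: cwf.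
Qed.

Lemma Rintegral01B (f1 f2 : R -> R) :
  (forall t, t \in `[0, 1]%R -> {for t, continuous f1}) ->
  (forall t, t \in `[0, 1]%R -> {for t, continuous f2}) ->
  \int[mu]_(t in `[0, 1]) (f1 t - f2 t) =
  \int[mu]_(t in `[0, 1]) f1 t - \int[mu]_(t in `[0, 1]) f2 t.
Proof.
move=> c1 c2; rewrite RintegralB //; exact: continuous_integrable01.
Qed.

Lemma is_derive_line (V W : normedModType R) (f : V -> W) (x h : V) (s : R) :
  differentiable f (s *: h + x) ->
  is_derive s 1 (fun s : R => f (s *: h + x)) ('D_h f (s *: h + x)).
Proof.
move=> df.
have ds : is_diff s (fun s : R => s *: h + x) (fun k => k *: h).
  by apply: is_diff_eq; apply/funext => k; rewrite !fctE addr0.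
have dfs : differentiable (fun s : R => f (s *: h + x)) s.
  by apply: differentiable_comp.
split; first exact: diff_derivable.
by rewrite deriveE // diff_comp // diff_val /= scale1r deriveE.
Qed.

Variable n : nat.
Implicit Types (g : R * 'rV[R]_n -> R) (U : set (R * 'rV[R]_n)) (B : set 'rV[R]_n).

(** The integrand lives on the product space, so that joint regularity in [t] and [x] is again an
    instance of [Ck]. *)
Definition integral01 g (x : 'rV[R]_n) : R := \int[mu]_(t in `[0, 1]) g (t, x).

Lemma continuous_slice g t x : differentiable g (t, x) ->
  {for t, continuous (fun t => g (t, x))}.
Proof.
move=> dg; apply: (@continuous_comp _ _ _ (fun t => (t, x)) g).
  by apply: differentiable_continuous; apply: differentiable_pair.
exact: differentiable_continuous.
Qed.

(** The mean value theorem bounds the first-order remainder for each [t]; compactness of [0, 1]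
    makes the bound uniform in [t], so it survives integration. *)
Lemma differentiable_integral01 U B g : open U -> open B ->
  (forall t x, t \in `[0, 1]%R -> B x -> U (t, x)) -> Ck 1 U g ->
  forall x, B x -> differentiable (integral01 g) x /\
   forall v, 'D_v (integral01 g) x = integral01 ('D_(0, v) g) x.
Proof.
move=> oU oB BU [dg Dg] x Bx.
pose e j : R * 'rV[R]_n := (0, delta_mx 0 j).
pose G j := 'D_(e j) g.
have dG j y : U y -> differentiable (G j) y by have [+ _] := Dg (e j); apply.
have DgE v y : U y -> 'D_(0, v) g y = \sum_j v 0 j * G j y.
  move=> Uy; rewrite deriveE; last exact: dg.
  have -> : (0, v) = \sum_j v 0 j *: e j.
    apply: injective_projections.
      by rewrite raddf_sum big1 // => j _; rewrite /= scaler0.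
    by rewrite raddf_sum [LHS]row_sum_delta.
  rewrite linear_sum; apply: eq_bigr => j _; rewrite linearZ /= /G deriveE //.
  exact: dg.
have cG j t : t \in `[0, 1]%R -> {for t, continuous (fun t => G j (t, x))}.
  by move=> t01; apply/continuous_slice/dG/BU.
have cg y t : B y -> t \in `[0, 1]%R -> {for t, continuous (fun t => g (t, y))}.
  by move=> By t01; apply/continuous_slice/dg/BU.
have intsum (w : 'rV[R]_n) : integral01 (fun y => \sum_j w 0 j * G j y) x =
    \sum_j w 0 j * integral01 (G j) x.
  by rewrite /integral01 Rintegral01_sum // => j t; exact: cG.
have [|d1 d2] := @differentiable_rV n (integral01 g) x (fun j => integral01 (G j) x).
  move=> e0 e0_gt0.
  (* Each of the [n] partial derivatives may contribute [eta * |h|]; [n.+1] keeps the denominator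
     nonzero when [n] is 0. *)
  pose eta := e0 / n.+1%:R.
  have eta0 : 0 < eta by rewrite divr_gt0.
  have near_x : \forall y \near x, forall j t, t \in `[0, 1]%R ->
      `|G j (t, x) - G j (t, y)| <= eta.
    suff H j : \forall y \near x, forall t, t \in `[0, 1]%R ->
        `|G j (t, x) - G j (t, y)| <= eta.
      exact: (@filter_forall _ _ _ (nbhs x) _ H).
    (* Near each [t], both [G j (t', x)] and [G j (t', y)] are within [eta / 2] of [G j (t, x)];
       compactness merges these neighbourhoods into one for [y]. *)
    have := @segment_compact R 0 1; rewrite compact_near_coveringP.
    move=> /(_ _ (nbhs x) (fun y t => `|G j (t, x) - G j (t, y)| <= eta)).
    apply => t t01 /=.
    have := differentiable_continuous (dG j _ (BU t x t01 Bx)).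
    move=> /cvgrPdist_lt/(_ (eta / 2)); rewrite divr_gt0 // => /(_ isT).
    move=> [[P Q] [/= nP nQ] PQ]; exists (P, Q) => //= -[t' y] [/= Pt Qy].
    have H1 := PQ (t', x) (conj Pt (nbhs_singleton nQ)).
    have H2 := PQ (t', y) (conj Pt Qy).
    rewrite -(subrKA (G j (t, x))) (le_trans (ler_normD _ _)) // (splitr eta).
    by rewrite lerD // ltW // distrC.
  have /nbhs_ballP[d /= d0 xd] : nbhs x ([set y | forall j t, t \in `[0, 1]%R ->
      `|G j (t, x) - G j (t, y)| <= eta] `&` B).
    by apply: filterI => //; exact: open_nbhs_nbhs.
  have : \forall h \near (0 : 'rV[R]_n), `|h| < d.
    by apply/nbhs_ballP; exists d => // h; rewrite -ball_normE /= sub0r normrN.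
  apply: filterS => h hd; rewrite -intsum.
  have hx s : s \in `[0, 1]%R -> ball x d (s *: h + x).
    rewrite in_itv /= => /andP[s0 s1].
    rewrite -ball_normE /= opprD addrCA subrr addr0 normrN normrZ (le_lt_trans _ hd) //.
    by rewrite ger0_norm // ler_piMl.
  have h1x : B (h + x).
    have /hx : (1 : R) \in `[0, 1]%R by rewrite in_itv /= ler01 lexx.
    by rewrite scale1r => /xd[].
  have c1 t : t \in `[0, 1]%R -> {for t, continuous (fun t => g (t, h + x) - g (t, x))}.
    by move=> t01; apply: cvgB; exact: cg.
  have c2 t : t \in `[0, 1]%R -> {for t, continuous (fun t => \sum_j h 0 j * G j (t, x))}.
    move=> t01; apply: continuous_at_sum => j.
    by apply: cvgM; [exact: cvg_cst|exact: cG].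
  rewrite /integral01 -Rintegral01B; try by move=> t; exact: cg.
  rewrite -Rintegral01B //.
  apply: normr_Rintegral01_le => t t01; first by apply: cvgB; [exact: c1|exact: c2].
  (* The intermediate point [s] depends on [t], but only the bound uniform in [s] is integrated, so
     its measurability is not at stake. *)
  have [s s01] : exists2 s : R, s \in `[0, 1]%R &
      g (t, h + x) - g (t, x) = \sum_j h 0 j * G j (t, s *: h + x).
    pose y (s : R) := g (s *: (0, h) + (t, x)).
    have yE s : s *: (0, h) + (t, x) = (t, s *: h + x) :> R * 'rV[R]_n.
      by apply: injective_projections; rewrite /= ?scaler0 ?add0r.
    have dy (s : R) : s \in `[0, 1]%R -> is_derive s 1 y (\sum_j h 0 j * G j (t, s *: h + x)).
      move=> s01; have Us : U (t, s *: h + x) by apply: BU => //; have [] := xd _ (hx _ s01).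
      rewrite -DgE // -yE; apply: is_derive_line; rewrite yE; exact: dg.
    pose y' (s : R) := \sum_j h 0 j * G j (t, s *: h + x).
    have cy : {within `[0, 1], continuous y}.
      apply: continuous_in_subspaceT => s; rewrite inE /= => s01.
      apply: differentiable_continuous; apply/derivable1_diffP.
      by have [] := dy s s01.
    have dy' (s : R) : s \in `]0, 1[%R -> is_derive s 1 y (y' s).
      by move=> s01; apply: dy; exact: subset_itv_oo_cc.
    have [s s01 ys] := MVT_segment ler01 dy' cy.
    by exists s => //; move: ys; rewrite subr0 mulr1 /y !yE scale0r add0r scale1r.
  move=> ->; rewrite -sumrB.
  under eq_bigr do rewrite -mulrBr.
  have [xs _] := xd _ (hx s s01).
  apply: (@le_trans _ _ (\sum_(j < n) (`|h| * eta))).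
    apply: (le_trans (ler_norm_sum _ _ _)); apply: ler_sum => j _.
    by rewrite normrM ler_pM //; [exact: norm_coord|rewrite distrC; exact: xs].
  rewrite sumr_const card_ord /eta -mulrnAr mulrC ler_wpM2r //.
  by rewrite -mulr_natr -mulrA ler_piMr ?(ltW e0_gt0)// mulrC ler_pdivrMr // mul1r ler_nat.
split=> // v; rewrite d2 -intsum.
apply: eq_Rintegral => t; rewrite inE => t01.
by rewrite DgE //; exact: BU.
Qed.

(** One order is lost because differentiation under the integral sign uses continuity of the
    derivative of the integrand, that is [Ck 1]. *)
Lemma Ck_integral01 k U B g : open U -> open B ->
  (forall t x, t \in `[0, 1]%R -> B x -> U (t, x)) ->
  Ck k.+1 U g -> Ck k B (integral01 g).
Proof.
move=> oU oB BU; elim: k g => [|k IH] g Hg.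
  by split=> // x Bx; have [] := differentiable_integral01 oU oB BU Hg Bx.
have Hg1 : Ck 1 U g.
  by move: Hg; clear; elim: k => [|k IHk] /CkS.
split=> [x Bx|v]; first by have [] := differentiable_integral01 oU oB BU Hg1 Bx.
have [_ /(_ (0, v))/IH] := Hg; apply: Ck_eq => // x Bx.
by have [_ ->] := differentiable_integral01 oU oB BU Hg1 Bx.
Qed.

End parametric_integral.

(** * Hadamard's lemma *)

Section Hadamard.
Variable R : realType.
Local Notation mu := (@lebesgue_measure R).

(** With [s = 0] this restricts to a coordinate hyperplane; with [s] a function of [x] it is a
    change of a single coordinate. *)
Definition set_coord n (i : 'I_n) (s : R) (x : 'rV[R]_n) : 'rV[R]_n :=
  \row_j (if j == i then s else x 0 j).

Lemma set_coordE n (i : 'I_n) (s : R) (x : 'rV[R]_n) j :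
  set_coord i s x 0 j = if j == i then s else x 0 j.
Proof. by rewrite mxE. Qed.

Lemma set_coord_line n (i : 'I_n) (s : R) (x : 'rV[R]_n) :
  set_coord i s x = s *: delta_mx 0 i + set_coord i 0 x.
Proof.
apply/rowP => j; rewrite !mxE /=.
by case: eqVneq; rewrite ?mulr1 ?addr0 ?mulr0 ?add0r.
Qed.

Lemma set_coord_id n (i : 'I_n) (x : 'rV[R]_n) : set_coord i (x 0 i) x = x.
Proof. by apply/rowP => j; rewrite set_coordE; case: eqVneq => [->|]. Qed.

Lemma mx_norm_lt n (x : 'rV[R]_n) (r : R) : 0 < r ->
  (forall j, `|x 0 j| < r) -> `|x| < r.
Proof.
move=> r0 H; rewrite [ltLHS]mx_normrE; apply/bigmax_ltP; split=> // -[i j] _ /=.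
by rewrite ord1.
Qed.

Lemma Ck_fst (V : normedModType R) k (D : set (R * V)) : Ck k D (fun p : R * V => p.1).
Proof. by apply: Ck_is_linear => // x; exact: cvg_fst. Qed.

Lemma Ck_snd_coord n k (D : set (R * 'rV[R]_n)) l :
  Ck k D (fun p : R * 'rV[R]_n => p.2 0 l).
Proof.
apply: Ck_is_linear => [a p q|x]; first by rewrite !mxE.
apply: (@continuous_comp _ _ _ snd (fun y : 'rV[R]_n => y 0 l)); first exact: cvg_snd.
exact: coord_continuous.
Qed.

Lemma FTC01 (f : R -> R) (df : R -> R) :
  (forall t : R, t \in `[0, 1]%R -> is_derive t 1 f (df t)) ->
  (forall t : R, t \in `[0, 1]%R -> {for t, continuous df}) ->
  \int[mu]_(t in `[0, 1]) df t = f 1 - f 0.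
Proof.
move=> fdf cdf; rewrite /Rintegral.
have cf t : t \in `[0, 1]%R -> {for t, continuous f}.
  move=> t01; apply/differentiable_continuous/derivable1_diffP.
  by have [] := fdf t t01.
rewrite (@continuous_FTC2 R df f 0 1) //.
- by apply: continuous_in_subspaceT => t; rewrite inE /=; exact: cdf.
- split.
  + by move=> t t01; have [] := fdf t (subset_itv_oo_cc t01).
  + by apply: cvg_at_right_filter; apply: cf; rewrite in_itv /= lexx ler01.
  + by apply: cvg_at_left_filter; apply: cf; rewrite in_itv /= lexx ler01.
- move=> t t01; rewrite derive1E; have := fdf t (subset_itv_oo_cc t01).
  by move=> ?; exact: derive_val.
Qed.

(** [Q x] is the integral over t in [0, 1] of the i-th partial derivative of [F] at [x] with its
    i-th coordinate multiplied by t. The fundamental theorem of calculus along this segment gives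
    the identity, and differentiation under the integral sign gives smoothness. *)
Lemma Hadamard n (i : 'I_n) (F : 'rV[R]_n -> R) : smooth_near 0 F ->
  exists Q : 'rV[R]_n -> R,
    [/\ smooth_near 0 Q, Q 0 = 'D_(delta_mx 0 i) F 0 &
        \forall x \near (0 : 'rV[R]_n),
          F x = F (set_coord i 0 x) + x 0 i * Q x].
Proof.
move=> /smooth_nearP[U [oU U0 UF]].
have [r /= r0 rU] : exists2 r : R, 0 < r & ball (0 : 'rV[R]_n) r `<=` U.
  by apply/nbhs_ballP; exact: open_nbhs_nbhs.
pose B := ball (0 : 'rV[R]_n) r.
have oB : open B by exact: ball_open.
have BE x : B x <-> `|x| < r by rewrite /B -ball_normE /= sub0r normrN.
pose L (p : R * 'rV[R]_n) : 'rV[R]_n := set_coord i (p.1 * p.2 0 i) p.2.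
have CL k D j : open D -> Ck k D (fun p => L p 0 j).
  move=> oD; have E p : L p 0 j = if j == i then p.1 * p.2 0 i else p.2 0 j.
    by rewrite set_coordE.
  under eq_fun do rewrite E.
  have C2 l : Ck k D (fun p : R * 'rV[R]_n => p.2 0 l) by exact: Ck_snd_coord.
  by case: eqP => // _; apply: CkM => //; exact: Ck_fst.
have cL : continuous L.
  move=> p; apply: differentiable_continuous; apply/differentiable_rowP => j.
  exact: (Ck_differentiable (CL 0%N setT j openT)).
(* Shrinking one coordinate does not leave a ball of the sup norm, so [W] is an open set containing
   [0, 1] x [B]. *)
pose W := L @^-1` B.
have oW : open W by exact: open_comp.
have BW t x : t \in `[0, 1]%R -> B x -> W (t, x).
  rewrite in_itv /= => /andP[t0 t1] /BE xr; apply/BE; apply: mx_norm_lt => // j.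
  rewrite set_coordE /=; case: eqP => _; apply: le_lt_trans xr; last exact: norm_coord.
  by rewrite normrM (le_trans _ (norm_coord x i)) // ler_piMl // ger0_norm.
pose g p := 'D_(delta_mx 0 i) F (L p).
have Cg k : Ck k W g.
  apply: (@Ck_comp _ _ _ k W B ('D_(delta_mx 0 i) F) L) => //.
  - by apply: (@Ck_subset _ _ _ _ U) => //; have [_] := UF k.+1; apply.
  - by move=> j; exact: CL.
exists (integral01 g); split.
- apply/smooth_nearP; exists B; split=> //; first exact/ballxx.
  by move=> k; apply: (Ck_integral01 oW).
- have -> : integral01 g 0 = \int[mu]_(t in `[0, 1]) 'D_(delta_mx 0 i) F 0.
    have L0 t : L (t, 0) = 0.
      by apply/rowP => j; rewrite set_coordE /= !mxE mulr0 if_same.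
    by apply: eq_Rintegral => t _; rewrite /g L0.
  by rewrite Rintegral_cst //= lebesgue_measure_itv /= lte01 /= oppr0 addr0 mulr1.
apply: filterS (open_nbhs_nbhs (conj oB (ballxx 0 r0))) => x Bx.
have dF t : t \in `[0, 1]%R -> differentiable F (L (t, x)).
  by move=> t01; apply: Ck_differentiable (UF 0%N) _; apply/rU/BW.
pose y (t : R) := F (t *: (x 0 i *: delta_mx 0 i) + set_coord i 0 x).
have LE t : t *: (x 0 i *: delta_mx 0 i) + set_coord i 0 x = L (t, x).
  by rewrite scalerA -set_coord_line.
have dfy (t : R) : t \in `[0, 1]%R -> is_derive t 1 y (x 0 i * g (t, x)).
  move=> t01.
  have := @is_derive_line _ _ _ F (set_coord i 0 x) (x 0 i *: delta_mx 0 i) t.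
  rewrite LE => /(_ (dF t t01)); rewrite deriveE; last exact: dF.
  by rewrite linearZ -deriveE; last exact: dF.
have cg t : t \in `[0, 1]%R -> {for t, continuous (fun t => g (t, x))}.
  by move=> t01; apply/continuous_slice/(Ck_differentiable (Cg 0%N))/BW.
have cxg t : t \in `[0, 1]%R -> {for t, continuous (fun t => x 0 i * g (t, x))}.
  by move=> t01; apply: continuousM; [exact: cvg_cst|exact: cg].
have -> : x 0 i * integral01 g x = y 1 - y 0.
  rewrite -(FTC01 dfy cxg) /integral01 RintegralZl //.
  exact: continuous_integrable01.
rewrite /y scale0r add0r LE /L /= mul1r set_coord_id.
by rewrite addrC subrK.
Qed.

End Hadamard.

(** * The implicit function theorem for one unknown *)

Section implicit_function.
Variable R : realType.

Lemma set_coord_set_coord n (i : 'I_n) (s s' : R) x :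
  set_coord i s (set_coord i s' x) = set_coord i s x.
Proof. by apply/rowP => j; rewrite !set_coordE; case: eqP. Qed.

Lemma set_coord0 n (i : 'I_n) : set_coord i 0 (0 : 'rV[R]_n) = 0.
Proof. by apply/rowP => j; rewrite set_coordE mxE; case: eqP. Qed.

Lemma Ck_set_coord (V : normedModType R) n (i : 'I_n) k (D : set V)
    (a : V -> R) (x : V -> 'rV[R]_n) j :
  Ck k D a -> Ck k D (fun p => x p 0 j) ->
  Ck k D (fun p => set_coord i (a p) (x p) 0 j).
Proof.
move=> Ca Cx; have E p : set_coord i (a p) (x p) 0 j = if j == i then a p else x p 0 j.
  by rewrite set_coordE.
by under eq_fun do rewrite E; case: eqP.
Qed.

Lemma near_shift0 (V : normedModType R) (x : V) (P : set V) :
  (\forall y \near x, P y) -> \forall h \near (0 : V), P (h + x).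
Proof. by rewrite (near_shift 0); apply: filterS => h /=; rewrite subr0. Qed.

Lemma differentiable_le (V W : normedModType R) (f : V -> W) x (e : R) :
  differentiable f x -> 0 < e ->
  \forall h \near (0 : V), `|f (h + x) - f x - 'd f x h| <= e * `|h|.
Proof.
move=> /diff_locally/eqaddoP H /H; rewrite !near_simpl.
by apply: filterS => h; rewrite /= !fctE /= opprD addrA.
Qed.

(** Coordinate [i] of [y] is freed by the substitution of [a y], and serves as the prescribed value
    of [F]. Differentiating the equation gives c_i da + sum_(j != i) c_j dx_j = dx_i, whence the
    formula; continuity of [a] suffices to justify it. *)
Lemma implicit_function_bound n (i : 'I_n) (F : 'rV[R]_n -> R) (a : 'rV[R]_n -> R)
    (x : 'rV[R]_n) (c := fun j => 'D_(delta_mx 0 j) F (set_coord i (a x) x)) :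
  differentiable F (set_coord i (a x) x) -> 0 < c i ->
  {for x, continuous a} ->
  (\forall y \near x, F (set_coord i (a y) y) = y 0 i) ->
  differentiable a x /\
  forall v, 'D_v a x = \sum_j v 0 j * ((if j == i then 1 else - c j) / c i).
Proof.
move=> dF ci0 ca aF; pose d j := (if j == i then 1 else - c j) / c i.
apply: differentiable_rV => e e0.
pose D := \sum_j `|d j|.
have D0 : 0 <= D by apply: sumr_ge0.
(* The bound [c i / 2] lets the term in [|k|] be absorbed on the left, giving
   [|k| <= (2 * D + 1) * |h|]; the other bound then turns [de * (|h| + |k|)] into at most
   [e * c i * |h|]. *)
pose de := Num.min (c i / 2) (e * c i / (2 * D + 2)).
have de0 : 0 < de.
  by rewrite lt_min !divr_gt0 ?mulr_gt0// ltr_wpDl // mulr_ge0.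
have /nbhs_ballP[eta /= eta0 He] : \forall w \near (0 : 'rV[R]_n),
    `|F (w + set_coord i (a x) x) - F (set_coord i (a x) x) - \sum_j w 0 j * c j| <= de * `|w|.
  apply: filterS (differentiable_le dF de0) => w.
  rewrite [in 'd _ _ w](row_sum_delta w) linear_sum.
  under eq_bigr do rewrite linearZ -deriveE //.
  by [].
have : \forall h \near (0 : 'rV[R]_n), [/\ `|h| < eta, `|a (h + x) - a x| < eta &
   F (set_coord i (a (h + x)) (h + x)) = (h + x) 0 i].
  have H1 : \forall h \near (0 : 'rV[R]_n), `|h| < eta.
    by apply/nbhs_ballP; exists eta => // h; rewrite -ball_normE /= sub0r normrN.
  have H2 : \forall h \near (0 : 'rV[R]_n), `|a (h + x) - a x| < eta.
    apply: (@near_shift0 _ x (fun y => `|a y - a x| < eta)).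
    by move: ca => /cvgrPdist_lt/(_ _ eta0); apply: filterS => y; rewrite distrC.
  by near=> h; split; near: h; [exact: H1|exact: H2|exact: near_shift0 aF].
apply: filterS => h [heta keta Fh].
set k := a (h + x) - a x.
pose w := set_coord i k h.
have wle : `|w| <= `|h| + `|k|.
  rewrite [leLHS]mx_normrE; apply/bigmax_leP; split; first by rewrite addr_ge0.
  move=> [l j] _ /=; rewrite ord1 set_coordE; case: eqP => _; first by rewrite lerDr.
  by rewrite (le_trans (norm_coord h j)) // lerDl.
have {}He := He w.
have wE : w + set_coord i (a x) x = set_coord i (a (h + x)) (h + x).
  by apply/rowP => j; rewrite !mxE; case: eqP => //; rewrite /k subrK.
have Fx : F (set_coord i (a x) x) = x 0 i by exact: nbhs_singleton aF.
(* The linear part of [F] along [w] is [c i] times the error to be estimated, plus [h 0 i], which is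
   exactly the increment of [F] and cancels. *)
have sumw : \sum_j w 0 j * c j = c i * (k - \sum_j h 0 j * d j) + h 0 i.
  rewrite (bigD1 i) //= [in RHS](bigD1 i) //= set_coordE eqxx /d eqxx.
  have -> : \sum_(j < n | j != i) w 0 j * c j = \sum_(j < n | j != i) h 0 j * c j.
    by apply: eq_bigr => j /negbTE ji; rewrite set_coordE ji.
  have -> : \sum_(j < n | j != i) h 0 j * ((if j == i then 1 else - c j) / c i) =
            - (\sum_(j < n | j != i) h 0 j * c j) / c i.
    rewrite -sumrN mulr_suml; apply: eq_bigr => j /negbTE ->.
    by rewrite mulrA mulrN.
  by field; rewrite gt_eqF.
rewrite wE Fh Fx mxE addrK sumw opprD addrCA subrr addr0 normrN normrM (gtr0_norm ci0) in He.
have {}He : c i * `|k - \sum_j h 0 j * d j| <= de * `|w|.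
  apply: He; rewrite -ball_normE /= sub0r normrN.
  apply: mx_norm_lt => // j.
  rewrite set_coordE; case: eqP => _ //; apply: le_lt_trans heta; exact: norm_coord.
have kD : `|\sum_j h 0 j * d j| <= D * `|h|.
  rewrite /D mulr_suml (le_trans (ler_norm_sum _ _ _)) // ler_sum // => j _.
  by rewrite normrM mulrC ler_wpM2l // norm_coord.
set S := \sum_j h 0 j * d j in He kD *.
have de1 : de <= c i / 2 by rewrite ge_min lexx.
have de2 : de <= e * c i / (2 * D + 2) by rewrite ge_min lexx orbT.
have {}He : c i * `|k - S| <= de * (`|h| + `|k|).
  by apply: (le_trans He); rewrite ler_wpM2l // ltW.
have kS : `|k| <= `|S| + `|k - S| by rewrite addrC -{1}(subrK S k) ler_normD.
have k1 : `|k| <= (2 * D + 1) * `|h|.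
  have H1 := ler_wpM2r (addr_ge0 (normr_ge0 h) (normr_ge0 k)) de1.
  have H2 := ler_wpM2l (ltW ci0) kS.
  have H3 := ler_wpM2l (ltW ci0) kD.
  by rewrite -(ler_pM2l ci0); lra.
rewrite -(ler_pM2l ci0); apply: (le_trans He).
have H1 : `|h| + `|k| <= (2 * D + 2) * `|h| by lra.
apply: (le_trans (ler_wpM2l (ltW de0) H1)).
have D2 : 0 < 2 * D + 2 by lra.
rewrite mulrA [leRHS]mulrA ler_wpM2r // -ler_pdivlMr //.
by rewrite [c i * e]mulrC.
Unshelve. all: by end_near.
Qed.

(** Near 0, [F] is strictly increasing in coordinate [i], so roots exist by the intermediate value
    theorem and are unique. The last two conclusions say that [a] and [F] invert each other in
    coordinate [i], with the other coordinates as parameters. *)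
Lemma implicit_function n (i : 'I_n) (F : 'rV[R]_n -> R) :
  smooth_near 0 F -> F 0 = 0 -> 0 < 'D_(delta_mx 0 i) F 0 ->
  exists a : 'rV[R]_n -> R,
    [/\ smooth_near 0 a, a 0 = 0,
        \forall x \near (0 : 'rV[R]_n), F (set_coord i (a x) x) = x 0 i &
        \forall x \near (0 : 'rV[R]_n), a (set_coord i (F x) x) = x 0 i].
Proof.
move=> /smooth_nearP[U [oU U0 UF]] F0 DF0.
have CDF j k : Ck k U ('D_(delta_mx 0 j) F) by have [_] := UF k.+1; apply.
have [r0 /= r0_gt0 rU] : exists2 r : R, 0 < r &
    ball (0 : 'rV[R]_n) r `<=` U `&` [set x | 0 < 'D_(delta_mx 0 i) F x].
  apply/nbhs_ballP; apply: filterI; first exact: open_nbhs_nbhs.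
  have cDF := differentiable_continuous (Ck_differentiable (CDF i 0%N) U0).
  exact: (cDF _ (open_nbhs_nbhs (conj (@open_gt R 0) DF0))).
pose B := ball (0 : 'rV[R]_n) r0.
have oB : open B by exact: ball_open.
have BE x : B x <-> `|x| < r0 by rewrite /B -ball_normE /= sub0r normrN.
have Bset s x : `|s| < r0 -> B x -> B (set_coord i s x).
  move=> sr /BE xr; apply/BE; apply: mx_norm_lt => // j.
  by rewrite set_coordE; case: eqP => // _; exact: le_lt_trans (norm_coord _ _) xr.
have mono x s s' : B x -> `|s| < r0 -> `|s'| < r0 -> s < s' ->
    F (set_coord i s x) < F (set_coord i s' x).
  move=> Bx sr sr' ss'.
  pose y (t : R) := F (t *: delta_mx 0 i + set_coord i 0 x).
  have yE t : y t = F (set_coord i t x) by rewrite /y -set_coord_line.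
  rewrite -!yE.
  have tr (t : R) : t \in `[s, s']%R -> `|t| < r0.
    move: sr sr'; rewrite !ltr_norml in_itv /= => /andP[s1 s2] /andP[s3 s4] /andP[st ts'].
    by rewrite (lt_le_trans s1 st) (le_lt_trans ts' s4).
  have dy (t : R) : t \in `[s, s']%R ->
      is_derive t 1 y ('D_(delta_mx 0 i) F (set_coord i t x)).
    move=> ts; rewrite set_coord_line; apply: is_derive_line.
    rewrite -set_coord_line; apply: (Ck_differentiable (UF 0%N)).
    by have [] := rU _ (Bset t x (tr t ts) Bx).
  rewrite -subr_gt0.
  pose y' (t : R) := 'D_(delta_mx 0 i) F (set_coord i t x).
  have cy : {within `[s, s'], continuous y}.
    apply: continuous_in_subspaceT => t; rewrite inE /= => ts.
    apply: differentiable_continuous; apply/derivable1_diffP.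
    by have [] := dy t ts.
  have dy' (t : R) : t \in `]s, s'[%R -> is_derive t 1 y (y' t).
    by move=> /subset_itv_oo_cc; exact: dy.
  have [t ts ->] := MVT ss' dy' cy.
  rewrite mulr_gt0 ?subr_gt0 //.
  by have [] := rU _ (Bset t x (tr t (subset_itv_oo_cc ts)) Bx).
have uniq x s s' : B x -> `|s| < r0 -> `|s'| < r0 ->
    F (set_coord i s x) = F (set_coord i s' x) -> s = s'.
  move=> Bx sr sr' ss'; case: (ltgtP s s') => // H.
  - by have := mono x s s' Bx sr sr' H; rewrite ss' ltxx.
  - by have := mono x s' s Bx sr' sr H; rewrite ss' ltxx.
have cF s x : B x -> `|s| < r0 ->
    {for x, continuous (fun x => F (set_coord i s x) - x 0 i)}.
  move=> Bx sr.
  suff : {for x, continuous (fun x => F (set_coord i s x))}.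
    by move=> cFs; exact: (continuousB cFs (@coord_continuous R 1 n 0 i x)).
  apply: differentiable_continuous; apply: (@Ck_differentiable _ _ _ 0 B) => //.
  apply: (@Ck_comp _ _ _ 0 B U F (set_coord i s)) => //.
  - by move=> z Bz; have [] := rU _ (Bset s z sr Bz).
  - by move=> j; apply: Ck_set_coord; [exact: Ck_cst|exact: Ck_coord].
(* Half the radius keeps [r] and [- r] strictly inside the range of monotonicity; on [N0] they
   bracket the root. *)
pose r := r0 / 2.
have r_gt0 : 0 < r by rewrite divr_gt0.
have rr0 : r < r0 by rewrite ltr_pdivrMr // ltr_pMr // ltr1n.
have rn : `|r| < r0 by rewrite gtr0_norm.
have rn' : `|- r| < r0 by rewrite normrN.
have B0 : B 0 by exact: ballxx.
have n0 : `|0 : R| < r0 by rewrite normr0.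
pose N0 := [set x | [/\ B x, F (set_coord i (- r) x) - x 0 i < 0 &
                       0 < F (set_coord i r x) - x 0 i]].
have N0_near : nbhs (0 : 'rV[R]_n) N0.
  have H1 : \forall x \near (0 : 'rV[R]_n), F (set_coord i (- r) x) - x 0 i < 0.
    apply: (cF _ _ B0 rn' [set y | y < 0]); apply: open_nbhs_nbhs; split.
      exact: open_lt.
    by rewrite /= mxE subr0 -F0 -[X in _ < F X](set_coord0 i); apply: mono; rewrite // oppr_lt0.
  have H2 : \forall x \near (0 : 'rV[R]_n), 0 < F (set_coord i r x) - x 0 i.
    apply: (cF _ _ B0 rn [set y | 0 < y]); apply: open_nbhs_nbhs; split.
      exact: open_gt.
    by rewrite /= mxE subr0 -F0 -[X in F X < _](set_coord0 i); apply: mono.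
  have H3 : \forall x \near (0 : 'rV[R]_n), B x by exact: open_nbhs_nbhs.
  by near=> x; split; near: x.
pose N := interior N0.
have oN : open N by exact: open_interior.
have NB x : N x -> B x by move=> /interior_subset[].
(* [xget] selects a root, and returns 0 where there is none; on [N] a root exists, and [uniq] makes
   it the only one. *)
pose a x := xget 0 [set s : R | `|s| < r0 /\ F (set_coord i s x) = x 0 i].
have aP x : N x -> `|a x| < r0 /\ F (set_coord i (a x) x) = x 0 i.
  move=> /interior_subset[Bx lo hi].
  suff [s sP] : exists s : R, `|s| < r0 /\ F (set_coord i s x) = x 0 i.
    exact: (@xgetPex _ 0 [set s : R | `|s| < r0 /\ F (set_coord i s x) = x 0 i] (ex_intro _ s sP)).
  have rr (s : R) : s \in `[- r, r]%R -> `|s| < r0.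
    by rewrite in_itv /= -ler_norml => /le_lt_trans; apply.
  have cFs : {within `[- r, r], continuous (fun s => F (set_coord i s x))}.
    apply: continuous_in_subspaceT => s; rewrite inE /= => sr.
    apply: differentiable_continuous.
    apply: (@Ck_differentiable _ _ _ 0 [set s : R | `|s| < r0]); last exact: rr.
    apply: (@Ck_comp _ _ _ 0 _ U F (fun s => set_coord i s x)).
    - exact: (open_comp (fun z _ => @norm_continuous R R z) (@open_lt R r0)).
    - by move=> z zr; have [] := rU _ (Bset z x zr Bx).
    - exact: UF.
    - by move=> j; apply: Ck_set_coord; [exact: Ck_id|exact: Ck_cst].
  have r2 : - r <= r by rewrite (@le_trans _ _ 0) ?oppr_le0 // ltW.
  have [|s sr Fs] := IVT (v := x 0 i) r2 cFs.
    by move: (ltW lo) (ltW hi); rewrite subr_le0 subr_ge0 ge_min le_max => -> ->; rewrite orbT.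
  by exists s; split; first exact: rr.
have aU x s : B x -> N x -> `|s| < r0 -> F (set_coord i s x) = x 0 i -> a x = s.
  by move=> Bx Nx sr Fs; have [ar Fa] := aP x Nx; apply: (uniq x); rewrite // Fa.
have ca x : N x -> {for x, continuous a}.
  move=> Nx; have [ar Fa] := aP x Nx.
  apply: (iffRL (@cvgrPdist_lt _ R _ (nbhs x) _ a (a x))) => e e0.
  (* [e'] also keeps [a x - e'] and [a x + e'] within the radius. The strict inequalities for [F] at
     these two values persist for [y] near [x], and monotonicity traps [a y] between them. *)
  pose e' := Num.min e ((r0 - `|a x|) / 2).
  have e'0 : 0 < e' by rewrite lt_min e0 divr_gt0 // subr_gt0.
  have e'e : e' <= e by rewrite ge_min lexx.
  have e'r : `|a x| + e' < r0.
    have : e' <= (r0 - `|a x|) / 2 by rewrite ge_min lexx orbT.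
    lra.
  have s1r : `|a x - e'| < r0.
    by apply: le_lt_trans (ler_normB _ _) _; rewrite (gtr0_norm e'0).
  have s2r : `|a x + e'| < r0.
    by apply: le_lt_trans (ler_normD _ _) _; rewrite (gtr0_norm e'0).
  have Bx := NB x Nx.
  have H1 : \forall y \near x, F (set_coord i (a x - e') y) - y 0 i < 0.
    apply: (cF _ _ Bx s1r [set y | y < 0]); apply: open_nbhs_nbhs; split.
      exact: open_lt.
    by rewrite /= subr_lt0 -Fa; apply: mono; rewrite // ltrBlDr ltrDl.
  have H2 : \forall y \near x, 0 < F (set_coord i (a x + e') y) - y 0 i.
    apply: (cF _ _ Bx s2r [set y | 0 < y]); apply: open_nbhs_nbhs; split.
      exact: open_gt.
    by rewrite /= subr_gt0 -Fa; apply: mono; rewrite // ltrDl.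
  have H3 : \forall y \near x, N y by exact: open_nbhs_nbhs.
  near=> y.
  have y1 : F (set_coord i (a x - e') y) - y 0 i < 0 by near: y; exact: H1.
  have y2 : 0 < F (set_coord i (a x + e') y) - y 0 i by near: y; exact: H2.
  have Ny : N y by near: y; exact: H3.
  have [ayr Fay] := aP y Ny; have By := NB y Ny.
  apply: lt_le_trans e'e; rewrite distrC ltr_distl; apply/andP; split.
  - rewrite ltNge; apply/negP => ay.
    move: ay y1; rewrite le_eqVlt => /predU1P[<-|ay]; first by rewrite Fay subrr ltxx.
    by have := mono y _ _ By ayr s1r ay; rewrite Fay subr_lt0 => /lt_trans H /H; rewrite ltxx.
  - rewrite ltNge; apply/negP => ay.
    move: ay y2; rewrite le_eqVlt => /predU1P[->|ay]; first by rewrite Fay subrr ltxx.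
    by have := mono y _ _ By s2r ayr ay; rewrite Fay subr_gt0 => /lt_trans H /H; rewrite ltxx.
pose psi x := set_coord i (a x) x.
have psiB x : N x -> B (psi x) by move=> Nx; have [? _] := aP x Nx; apply: Bset => //; exact: NB.
have da x : N x -> differentiable a x /\
  forall v, 'D_v a x = \sum_j v 0 j * ((if j == i then 1 else - 'D_(delta_mx 0 j) F (psi x)) /
     'D_(delta_mx 0 i) F (psi x)).
  move=> Nx; have [UB pB] := rU _ (psiB x Nx).
  apply: implicit_function_bound => //; [|exact: ca|].
    exact: (Ck_differentiable (UF 0%N)).
  by apply: filterS (open_nbhs_nbhs (conj oN Nx)) => y /aP[].
(* Bootstrap: ['D_v a] is a rational expression in the partial derivatives of [F] at [psi x], and
   [psi] is as regular as [a], so each order gives the next. *)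
have Ca k : Ck k N a.
  elim: k => [|k IH]; first by split=> // x /da[].
  split=> [x /da[]//|v].
  have Cpsi j : Ck k N (fun x => psi x 0 j) by apply: Ck_set_coord => //; exact: Ck_coord.
  have CD j : Ck k N (fun x => 'D_(delta_mx 0 j) F (psi x)).
    apply: (@Ck_comp _ _ _ k N U ('D_(delta_mx 0 j) F) psi) => //.
    by move=> x /psiB/rU[].
  have H : Ck k N (fun x => \sum_j v 0 j * ((if j == i then 1 else - 'D_(delta_mx 0 j) F (psi x)) /
     'D_(delta_mx 0 i) F (psi x))).
    apply: Ck_sum => // j; apply: CkM => //; first exact: Ck_cst.
    apply: CkM => //.
      case: eqP => _; first exact: (Ck_cst k N (1 : R)).
      under eq_fun do rewrite -mulN1r.
      by apply: CkM => //; exact: (Ck_cst k N (-1 : R)).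
    by apply: CkV => // x /psiB/rU[_ /= /gt_eqF ->].
  by apply: Ck_eq H => // x /da[_ ->].
have N_0 : N 0 by exact: N0_near.
exists a; split.
- by apply/smooth_nearP; exists N.
- by apply: aU => //; rewrite set_coord0 F0 mxE.
- by apply: filterS (open_nbhs_nbhs (conj oN N_0)) => y /aP[].
(* For the converse identity, [x 0 i] is itself a root for the point [set_coord i (F x) x], so
   uniqueness applies as soon as that point lies in [N]. *)
have H1 : \forall x \near (0 : 'rV[R]_n), N (set_coord i (F x) x).
  have : {for (0 : 'rV[R]_n), continuous (fun x : 'rV[R]_n => set_coord i (F x) x)}.
    apply/differentiable_continuous/differentiable_rowP => j.
    apply: (@Ck_differentiable _ _ _ 0 U) => //.
    by apply: Ck_set_coord; [exact: UF|exact: Ck_coord].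
  by apply; apply: open_nbhs_nbhs; rewrite F0 set_coord0.
have H2 : \forall x \near (0 : 'rV[R]_n), B x by exact: open_nbhs_nbhs.
apply: filterS2 H1 H2 => x Nx Bx; apply: aU => //; first exact: NB.
  by apply: le_lt_trans (norm_coord _ _) _; exact/BE.
by rewrite set_coord_set_coord set_coord_id set_coordE eqxx.
Unshelve. all: by end_near.
Qed.


End implicit_function.

(** * Adapted orthonormal frames *)

Section frame.
Variable R : realType.

Lemma ord3_ind (P : 'I_3 -> Prop) : P 0 -> P 1 -> P 2%:R -> forall j, P j.
Proof.
move=> P0 P1 P2 [[|[|[|//]]] j3].
- by rewrite (_ : Ordinal j3 = 0) //; exact: val_inj.
- by rewrite (_ : Ordinal j3 = 1) //; exact: val_inj.
- by rewrite (_ : Ordinal j3 = 2%:R) //; exact: val_inj.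
Qed.

Lemma ord2_ind (P : 'I_2 -> Prop) : P 0 -> P 1 -> forall j, P j.
Proof.
move=> P0 P1 [[|[|//]] j3].
- by rewrite (_ : Ordinal j3 = 0) //; exact: val_inj.
- by rewrite (_ : Ordinal j3 = 1) //; exact: val_inj.
Qed.

Lemma sum3E (V : nmodType) (f : 'I_3 -> V) : \sum_j f j = f 0 + f 1 + f 2%:R.
Proof.
rewrite !big_ord_recl big_ord0 addr0 addrA.
by congr (f _ + f _ + f _); exact: val_inj.
Qed.

Lemma vec3E0 (a b c : R) : vec3 a b c 0 0 = a. Proof. by rewrite mxE. Qed.
Lemma vec3E1 (a b c : R) : vec3 a b c 0 1 = b. Proof. by rewrite mxE. Qed.
Lemma vec3E2 (a b c : R) : vec3 a b c 0 2%:R = c. Proof. by rewrite mxE. Qed.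
Definition vec3E := (vec3E0, vec3E1, vec3E2).

Lemma vec3P (x y : 'rV[R]_3) :
  x 0 0 = y 0 0 -> x 0 1 = y 0 1 -> x 0 2%:R = y 0 2%:R -> x = y.
Proof. by move=> x0 x1 x2; apply/rowP; apply: ord3_ind. Qed.

Definition dot (u v : 'rV[R]_3) : R := \sum_j u 0 j * v 0 j.

Lemma dot_gt0 u : u != 0 -> 0 < dot u u.
Proof.
move=> u0; rewrite lt_def sumr_ge0 ?andbT; last by move=> j _; rewrite -expr2 sqr_ge0.
apply: contra u0; rewrite psumr_eq0; last by move=> j _; rewrite -expr2 sqr_ge0.
move=> /allP H; apply/eqP/rowP => j; rewrite mxE.
by have := H j (mem_index_enum _); rewrite mulf_eq0 orbb => /eqP.
Qed.

(** The columns of [M] are the Gram-Schmidt vectors e1, e2 of [p], [q] and the cross product e3, so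
    the coordinates of [x *m M] are scalar products with them. Nothing fixes the sign of the scalar
    product of [s] with e3. *)
Lemma orthonormal_frame (p q s : 'rV[R]_3) : p != 0 ->
  (forall k, q != k *: p) ->
  (forall x, exists c0 c1 c2, x = c0 *: p + c1 *: q + c2 *: s) ->
  exists M : 'M[R]_3, [/\ M *m M^T = 1%:M,
    [/\ 0 < (p *m M) 0 0, (p *m M) 0 1 = 0 & (p *m M) 0 2%:R = 0],
    0 < (q *m M) 0 1, (q *m M) 0 2%:R = 0 & (s *m M) 0 2%:R != 0].
Proof.
move=> p0 qp span.
pose np := Num.sqrt (dot p p).
have np0 : 0 < np by rewrite sqrtr_gt0 dot_gt0.
have np2 : np ^+ 2 = dot p p by rewrite sqr_sqrtr // ltW // dot_gt0.
pose e1 := np^-1 *: p.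
pose q' := q - dot q e1 *: e1.
have q'0 : q' != 0 by rewrite subr_eq0 /e1 scalerA qp.
pose nq := Num.sqrt (dot q' q').
have nq0 : 0 < nq by rewrite sqrtr_gt0 dot_gt0.
have nq2 : nq ^+ 2 = dot q' q' by rewrite sqr_sqrtr // ltW // dot_gt0.
pose e2 := nq^-1 *: q'.
pose e3 := vec3 (e1 0 1 * e2 0 2%:R - e1 0 2%:R * e2 0 1)
                (e1 0 2%:R * e2 0 0 - e1 0 0 * e2 0 2%:R)
                (e1 0 0 * e2 0 1 - e1 0 1 * e2 0 0).
have dotC u v : dot u v = dot v u by apply: eq_bigr => j _; rewrite mulrC.
have dotZ k u v : dot (k *: u) v = k * dot u v.
  by rewrite /dot mulr_sumr; apply: eq_bigr => j _; rewrite mxE mulrA.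
have dotD u v w : dot (u + v) w = dot u w + dot v w.
  by rewrite /dot -big_split; apply: eq_bigr => j _; rewrite mxE mulrDl.
have e11 : dot e1 e1 = 1.
  by rewrite dotZ dotC dotZ mulrA -expr2 -np2 -exprMn mulVf ?expr1n // gt_eqF.
have q'1 : dot q' e1 = 0.
  by rewrite dotD -scaleNr dotZ e11 mulr1 subrr.
have e21 : dot e2 e1 = 0 by rewrite dotZ q'1 mulr0.
have e22 : dot e2 e2 = 1.
  by rewrite dotZ dotC dotZ mulrA -expr2 -nq2 -exprMn mulVf ?expr1n // gt_eqF.
have e31 : dot e3 e1 = 0 by rewrite /dot sum3E !vec3E; ring.
have e32 : dot e3 e2 = 0 by rewrite /dot sum3E !vec3E; ring.
have e33 : dot e3 e3 = 1.
  (* Lagrange's identity for the norm of a cross product. *)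
  have : dot e3 e3 = dot e1 e1 * dot e2 e2 - dot e2 e1 ^+ 2.
    by rewrite /dot !sum3E !vec3E; ring.
  by rewrite e11 e22 e21 => ->; rewrite expr0n subr0 mulr1.
pose e (j : 'I_3) := [:: e1; e2; e3]`_j.
pose M : 'M[R]_3 := \matrix_(i, j) e j 0 i.
have ME x j : (x *m M) 0 j = dot x (e j).
  by rewrite mxE; apply: eq_bigr => k _; rewrite mxE.
have eo i j : dot (e i) (e j) = (i == j)%:R.
  by move: i j; apply: ord3_ind; apply: ord3_ind; rewrite /e //= dotC.
have pe1 : p = np *: e1 by rewrite /e1 scalerA divff ?scale1r // gt_eqF.
have qe : q = dot q e1 *: e1 + nq *: e2.
  by rewrite [nq *: e2]scalerA divff ?scale1r ?gt_eqF // addrC subrK.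
have pe3 : dot p e3 = 0 by rewrite pe1 dotZ dotC e31 mulr0.
have qe3 : dot q e3 = 0.
  by rewrite qe dotD (dotZ nq) (dotZ (dot q e1)) !(dotC _ e3) e31 e32 !mulr0 addr0.
have e3s : dot s e3 != 0.
  (* As [e3] is orthogonal to [p] and [q], expanding it in [p], [q], [s] gives 1 = c2 * dot s e3. *)
  have [c0 [c1 [c2 e3E]]] := span e3.
  have : dot e3 e3 = c2 * dot s e3.
    by rewrite [in X in dot X _]e3E !dotD !(dotZ c0, dotZ c1, dotZ c2) pe3 qe3 !mulr0 !add0r.
  by rewrite e33 => H; apply/negP => /eqP s0; move/eqP: H; rewrite s0 mulr0 oner_eq0.
exists M; split.
- apply: mulmx1C; apply/matrixP => i j; rewrite !mxE -eo.
  by apply: eq_bigr => k _; rewrite !mxE.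
- rewrite !ME /e /= pe3 pe1 !(dotZ np) e11 (dotC e1) e21 mulr0 mulr1.
  by split.
- by rewrite ME /e /= qe dotD (dotZ nq) e22 (dotZ (dot q e1)) (dotC e1 e2) e21 mulr0 add0r mulr1.
- by rewrite ME.
- by rewrite ME.
Qed.

(** Meant for the differential at 0 of the inverse target diffeomorphism, whose own inverse is the
    differential of the diffeomorphism. *)
Lemma linear_frame (d d' : {linear 'rV[R]_3 -> 'rV[R]_3}) :
  (forall v, d' (d v) = v) -> (forall v, d (d' v) = v) ->
  exists M : 'M[R]_3, [/\ M *m M^T = 1%:M,
    [/\ 0 < (d (delta_mx 0 0) *m M) 0 0, (d (delta_mx 0 0) *m M) 0 1 = 0 &
        (d (delta_mx 0 0) *m M) 0 2%:R = 0],
    0 < (d (delta_mx 0 1) *m M) 0 1, (d (delta_mx 0 1) *m M) 0 2%:R = 0 &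
    (d (delta_mx 0 2%:R) *m M) 0 2%:R != 0].
Proof.
move=> d'd dd'; apply: orthonormal_frame.
- apply/eqP => /(congr1 d'); rewrite d'd linear0 => /rowP/(_ 0).
  by rewrite !mxE /= => /eqP; rewrite oner_eq0.
- move=> k; apply/eqP => /(congr1 d'); rewrite linearZ /= !d'd => /rowP/(_ 1).
  by rewrite !mxE /= mulr0 => /eqP; rewrite oner_eq0.
- move=> x; exists (d' x 0 0), (d' x 0 1), (d' x 0 2%:R).
  by rewrite -[LHS]dd' [in LHS](row_sum_delta (d' x)) sum3E !linearD !linearZ.
Qed.

Lemma isometry_mulmx n (M : 'M[R]_n) : M *m M^T = 1%:M ->
  isometry_germ (fun x : 'rV[R]_n => x *m M).
Proof.
move=> MM; split; last exact: mul0mx.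
split; first by exists (fun x => x *m M^T) => x; rewrite -mulmxA ?MM ?(mulmx1C MM) mulmx1.
move=> x y; rewrite /euclidean_dist; congr Num.sqrt.
have E (z w : 'rV[R]_n) : \sum_i (z 0 i - w 0 i) ^+ 2 = ((z - w) *m (z - w)^T) 0 0.
  by rewrite mxE; apply: eq_bigr => i _; rewrite !mxE expr2.
by rewrite !E -mulmxBl trmx_mul mulmxA -[_ *m M *m _]mulmxA MM mulmx1.
Qed.

Lemma isometry_germ_comp n (Phi Psi : 'rV[R]_n -> 'rV[R]_n) :
  isometry_germ Phi -> isometry_germ Psi -> isometry_germ (Phi \o Psi).
Proof.
move=> [[bP iP] P0] [[bQ iQ] Q0]; split; last by rewrite /= Q0.
by split=> [|x y]; [exact: bij_comp|rewrite /= iP].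
Qed.

Lemma map_germ_continuous n m (f : 'rV[R]_n -> 'rV[R]_m) (P : set 'rV[R]_m) :
  map_germ f -> (\forall y \near (0 : 'rV[R]_m), P y) ->
  \forall x \near (0 : 'rV[R]_n), P (f x).
Proof. by move=> [f0 /smooth_near_continuous cf] P0; apply: cf; rewrite f0. Qed.

Lemma map_germ_comp n m l (f : 'rV[R]_n -> 'rV[R]_m) (g : 'rV[R]_l -> 'rV[R]_n) :
  map_germ f -> map_germ g -> map_germ (fun x => f (g x)).
Proof.
move=> [f0 sf] [g0 sg]; split; first by rewrite g0.
by apply: smooth_near_comp_row => //; rewrite g0.
Qed.

Lemma diffeo_germ_comp n (f g : 'rV[R]_n -> 'rV[R]_n) :
  diffeo_germ f -> diffeo_germ g -> diffeo_germ (fun x => f (g x)).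
Proof.
move=> [mf [f' [mf' f'f ff']]] [mg [g' [mg' g'g gg']]].
split; first exact: map_germ_comp.
exists (fun x => g' (f' x)); split; first exact: map_germ_comp.
- by apply: filterS2 (map_germ_continuous mg f'f) g'g => x /= ->.
- by apply: filterS2 (map_germ_continuous mf' gg') ff' => x /= ->.
Qed.

Lemma diffeo_germ_derive n (f g : 'rV[R]_n -> 'rV[R]_n) :
  map_germ f -> map_germ g -> (\forall x \near (0 : 'rV[R]_n), f (g x) = x) ->
  forall v, 'd f 0 ('d g 0 v) = v.
Proof.
move=> [f0 /smooth_near_differentiable df] [g0 /smooth_near_differentiable dg] fg v.
have dfg : differentiable f (g 0) by rewrite g0.
have := @diff_comp _ _ _ _ g f 0 dg dfg => /(congr1 (@^~ v)) /=; rewrite g0 => <-.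
rewrite -deriveE; last exact: differentiable_comp.
by rewrite (near_eq_derive (g := id)) ?derive_id.
Qed.

Lemma cuspidal_edge_frame (f : 'rV[R]_2 -> 'rV[R]_3) :
  map_germ f -> A_equivalent f (@standard_cuspidal_edge R) ->
  exists (sigma : 'rV[R]_2 -> 'rV[R]_2) (Phi G : 'rV[R]_3 -> 'rV[R]_3),
    [/\ diffeo_germ sigma, isometry_germ Phi, map_germ G,
     \forall x \near (0 : 'rV[R]_2), Phi (f (sigma x)) = G (standard_cuspidal_edge x) &
     [/\ 0 < ('D_(delta_mx 0 0) G 0) 0 0, ('D_(delta_mx 0 0) G 0) 0 1 = 0,
         0 < ('D_(delta_mx 0 1) G 0) 0 1 &
         [/\ ('D_(delta_mx 0 0) G 0) 0 2%:R = 0,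
             ('D_(delta_mx 0 1) G 0) 0 2%:R = 0 &
             ('D_(delta_mx 0 2%:R) G 0) 0 2%:R != 0]]].
Proof.
move=> mf [S [T [[mS [S' [mS' S'S SS']]] [mT [T' [mT' T'T TT']]] ST]]].
have T'_inj v : 'd T 0 ('d T' 0 v) = v by exact: diffeo_germ_derive.
have T'_surj v : 'd T' 0 ('d T 0 v) = v by exact: diffeo_germ_derive.
have [M [MM [p0 p1 p2] q1 q2 s2]] := linear_frame T'_inj T'_surj.
have dT' : differentiable T' 0 by case: mT' => _ /smooth_near_differentiable.
(* From [cusp o S = T o f] follows [f o S' = T' o cusp]; the frame [M] is then applied on the target
   side. *)
pose G x := T' x *m M.
have sG : smooth_near 0 G.
  apply/smooth_near_rowP => j; under eq_fun do rewrite mxE.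
  apply: smooth_near_sum => k; apply: smooth_nearM; last exact: smooth_near_cst.
  by case: mT' => _ /smooth_near_rowP.
have DG v : 'D_v G 0 = 'd T' 0 v *m M.
  apply/rowP => j; rewrite derive_row; last exact: smooth_near_differentiable.
  have -> : (fun y => G y 0 j) = \sum_k (fun y => T' y 0 k * M k j).
    by apply/funext => y; rewrite fct_sumE /G mxE.
  have dT'k k : derivable (fun y => T' y 0 k) 0 v.
    by apply: diff_derivable; move/differentiable_rowP : dT'.
  rewrite derive_sum; last by move=> k; apply: derivableM.
  rewrite mxE; apply: eq_bigr => k _.
  by rewrite deriveMr // -derive_row // deriveE // mulrC.
exists S', (fun x => x *m M), G; split.
- by split=> //; exists S.
- exact: isometry_mulmx.
- by split=> //; rewrite /G; case: mT' => -> _; rewrite mul0mx.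
- have mfS' : map_germ (fun x => f (S' x)) by exact: map_germ_comp.
  have H1 := map_germ_continuous mfS' T'T.
  have H2 := map_germ_continuous mS' ST.
  by apply: filterS3 H1 H2 SS' => x H1 H2 H3; rewrite /G -H1 -H2 H3.
- by rewrite !DG.
Qed.

End frame.

(** * Expansions along the cuspidal edge *)

Section normal_form.
Variable R : realType.

Definition vec2 (a b : R) : 'rV[R]_2 := \row_(j < 2) [:: a; b]`_j.

Lemma vec2E0 (a b : R) : vec2 a b 0 0 = a. Proof. by rewrite mxE. Qed.
Lemma vec2E1 (a b : R) : vec2 a b 0 1 = b. Proof. by rewrite mxE. Qed.

Lemma vec2_0 : vec2 0 0 = 0.
Proof. by apply/rowP; apply: ord2_ind; rewrite !mxE. Qed.

Lemma vec3_0 : vec3 0 0 0 = 0 :> 'rV[R]_3.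
Proof. by apply/rowP; apply: ord3_ind; rewrite !mxE. Qed.

Lemma smooth_near_vec2 (V : normedModType R) (a : V) (f g : V -> R) :
  smooth_near a f -> smooth_near a g -> smooth_near a (fun x => vec2 (f x) (g x)).
Proof.
move=> sf sg; apply/smooth_near_rowP; apply: ord2_ind.
- by under eq_fun do rewrite vec2E0.
- by under eq_fun do rewrite vec2E1.
Qed.

Lemma smooth_near_vec3 (V : normedModType R) (a : V) (f g h : V -> R) :
  smooth_near a f -> smooth_near a g -> smooth_near a h ->
  smooth_near a (fun x => vec3 (f x) (g x) (h x)).
Proof.
move=> sf sg sh; apply/smooth_near_rowP; apply: ord3_ind.
- by under eq_fun do rewrite vec3E0.
- by under eq_fun do rewrite vec3E1.
- by under eq_fun do rewrite vec3E2.
Qed.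

Lemma smooth_near_comp_vec3 (V : normedModType R) (a : V) (F : 'rV[R]_3 -> R)
    (f g h : V -> R) :
  smooth_near 0 F -> smooth_near a f -> smooth_near a g -> smooth_near a h ->
  f a = 0 -> g a = 0 -> h a = 0 -> smooth_near a (fun x => F (vec3 (f x) (g x) (h x))).
Proof.
move=> sF sf sg sh fa ga ha; apply: smooth_near_comp; last exact: smooth_near_vec3.
by rewrite fa ga ha vec3_0.
Qed.

Lemma smooth_near_near (V W : normedModType R) (a : V) (g : V -> W) (P : set W) :
  smooth_near a g -> (\forall y \near g a, P y) -> \forall x \near a, P (g x).
Proof. by move=> /smooth_near_continuous cg Pa; exact: cg. Qed.

Lemma smooth_near_set_coord (V : normedModType R) n (i : 'I_n) (a : V)
    (f : V -> R) (g : V -> 'rV[R]_n) :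
  smooth_near a f -> smooth_near a g -> smooth_near a (fun x => set_coord i (f x) (g x)).
Proof.
move=> sf sg; apply/smooth_near_rowP => j.
under eq_fun do rewrite set_coordE; case: eqP => _ //.
by move/smooth_near_rowP : sg.
Qed.

Lemma smooth_near_rV_id n (a : 'rV[R]_n) : smooth_near a (fun x : 'rV[R]_n => x).
Proof. by apply/smooth_near_rowP => j; exact: smooth_near_coord. Qed.

(** The two last hypotheses have the shape of the conclusions of [implicit_function], from which the
    inverse germ is read off. *)
Lemma diffeo_germ_set_coord n (i : 'I_n) (f g : 'rV[R]_n -> R) :
  smooth_near 0 f -> smooth_near 0 g -> f 0 = 0 -> g 0 = 0 ->
  (\forall x \near (0 : 'rV[R]_n), f (set_coord i (g x) x) = x 0 i) ->
  (\forall x \near (0 : 'rV[R]_n), g (set_coord i (f x) x) = x 0 i) ->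
  diffeo_germ (fun x => set_coord i (f x) x).
Proof.
move=> sf sg f0 g0 fg gf.
have H h : smooth_near 0 h -> h 0 = 0 -> map_germ (fun x : 'rV[R]_n => set_coord i (h x) x).
  move=> sh h0; split; first by rewrite h0 set_coord0.
  by apply: smooth_near_set_coord => //; exact: smooth_near_rV_id.
split; first exact: H.
exists (fun x => set_coord i (g x) x); split; first exact: H.
- by apply: filterS gf => x gfx; rewrite gfx set_coord_set_coord set_coord_id.
- by apply: filterS fg => x fgx; rewrite fgx set_coord_set_coord set_coord_id.
Qed.

Lemma Hadamard1 (f : R -> R) : smooth_near 0 f ->
  exists2 q : R -> R, smooth_near 0 q & \forall u \near (0 : R), f u = f 0 + u * q u.
Proof.
move=> sf; pose c (u : R) : 'rV[R]_1 := \row_j u.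
have sc : smooth_near 0 c.
  by apply/smooth_near_rowP => j; under eq_fun do rewrite mxE; exact: smooth_near_id.
have c0 : c 0 = 0 by apply/rowP => j; rewrite !mxE.
have sF : smooth_near 0 (fun x : 'rV[R]_1 => f (x 0 0)).
  by apply: smooth_near_comp1; [rewrite mxE|exact: smooth_near_coord].
have [Q [sQ _ FQ]] := Hadamard 0 sF.
exists (Q \o c); first by apply: smooth_near_comp => //; rewrite c0.
rewrite -c0 in FQ; apply: filterS (smooth_near_near sc FQ) => u /=.
by rewrite set_coordE eqxx mxE.
Qed.

(** Hadamard's lemma is used four times, once on R^3 and three times on the line; the linear
    coefficient is the derivative assumed to vanish. *)
Lemma axis_expansion (F : 'rV[R]_3 -> R) :
  smooth_near 0 F -> F 0 = 0 -> 'D_(delta_mx 0 0) F 0 = 0 ->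
  exists (c2 c3 : R) (h : R -> R), smooth_near 0 h /\
    \forall u \near (0 : R),
      F (vec3 u 0 0) = c2 / 2 * u ^+ 2 + c3 / 6 * u ^+ 3 + u ^+ 4 * h u.
Proof.
move=> sF F0 DF0; have [Q [sQ Q0 FQ]] := Hadamard 0 sF.
pose q u := Q (vec3 u 0 0).
have sv : smooth_near (0 : R) (fun u => vec3 u 0 0).
  by apply: smooth_near_vec3; [exact: smooth_near_id|exact: smooth_near_cst..].
have sq : smooth_near 0 q by apply: smooth_near_comp => //; rewrite vec3_0.
have q0 : q 0 = 0 by rewrite /q vec3_0 Q0.
have [q1 sq1 qq1] := Hadamard1 sq.
have [q2 sq2 qq2] := Hadamard1 sq1.
have [q3 sq3 qq3] := Hadamard1 sq2.
exists (2 * q1 0), (6 * q2 0), q3; split=> //.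
have FQ' : \forall u \near (0 : R), F (vec3 u 0 0) = u * q u.
  rewrite -vec3_0 in FQ; apply: filterS (smooth_near_near sv FQ) => u ->.
  rewrite vec3E0 (_ : set_coord 0 0 (vec3 u 0 0) = 0) ?F0 ?add0r //.
  by apply/rowP; apply: ord3_ind; rewrite !mxE.
near=> u.
have -> : F (vec3 u 0 0) = u * q u by near: u.
have -> : q u = q 0 + u * q1 u by near: u.
have -> : q1 u = q1 0 + u * q2 u by near: u.
have -> : q2 u = q2 0 + u * q3 u by near: u.
by rewrite q0; field.
Unshelve. all: by end_near.
Qed.

(** Division by y at (u, v^2, v^3), then by z at (u, 0, v^3). As [P] is again evaluated on the cusp,
    the expansion can be repeated on [P]. *)
Lemma cuspidal_expansion (F : 'rV[R]_3 -> R) : smooth_near 0 F ->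
  exists P Q : 'rV[R]_3 -> R,
    [/\ smooth_near 0 P, smooth_near 0 Q, P 0 = 'D_(delta_mx 0 1) F 0,
        Q 0 = 'D_(delta_mx 0 2%:R) F 0 &
        \forall x \near (0 : 'rV[R]_2),
          F (standard_cuspidal_edge x) = F (vec3 (x 0 0) 0 0) +
            x 0 1 ^+ 2 * P (standard_cuspidal_edge x) +
            x 0 1 ^+ 3 * Q (vec3 (x 0 0) 0 (x 0 1 ^+ 3))].
Proof.
move=> sF; have [P [sP P0 FP]] := Hadamard 1 sF; have [Q [sQ Q0 FQ]] := Hadamard 2%:R sF.
exists P, Q; split=> //.
have scoord i := @smooth_near_coord R 2 0 i.
have scusp : smooth_near 0 (@standard_cuspidal_edge R).
  by apply: smooth_near_vec3 => //; exact: smooth_nearX.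
have scusp' : smooth_near 0 (fun x : 'rV[R]_2 => vec3 (x 0 0) 0 (x 0 1 ^+ 3)).
  by apply: smooth_near_vec3 => //; [exact: smooth_near_cst|exact: smooth_nearX].
have cusp0 : standard_cuspidal_edge (0 : 'rV[R]_2) = 0.
  by rewrite /standard_cuspidal_edge !mxE !expr0n vec3_0.
rewrite -cusp0 in FP.
have FQ' : \forall y \near vec3 ((0 : 'rV[R]_2) 0 0) 0 ((0 : 'rV[R]_2) 0 1 ^+ 3),
    F y = F (set_coord 2%:R 0 y) + y 0 2%:R * Q y.
  by rewrite !mxE expr0n vec3_0.
apply: filterS2 (smooth_near_near scusp FP) (smooth_near_near scusp' FQ') => x.
rewrite /standard_cuspidal_edge !vec3E /=.
have -> : set_coord 1 0 (vec3 (x 0 0) (x 0 1 ^+ 2) (x 0 1 ^+ 3)) =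
    vec3 (x 0 0) 0 (x 0 1 ^+ 3) by apply: vec3P; rewrite !mxE.
have -> : set_coord 2%:R 0 (vec3 (x 0 0) 0 (x 0 1 ^+ 3)) = vec3 (x 0 0) 0 0.
  by apply: vec3P; rewrite !mxE.
by move=> -> ->; rewrite addrAC.
Qed.

End normal_form.

(** * Normalization of the coordinates *)

Section main.
Variable R : realType.
Local Notation cusp := (@standard_cuspidal_edge R).

Lemma smooth_near_cusp : smooth_near 0 cusp.
Proof.
have scoord i := @smooth_near_coord R 2 0 i.
by apply: smooth_near_vec3 => //; exact: smooth_nearX.
Qed.

Lemma cusp_at0 : cusp 0 = 0.
Proof. by rewrite /standard_cuspidal_edge !mxE !expr0n vec3_0. Qed.

(** This compatibility turns a change of the first coordinate of R^3 into a change of u in the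
    source. *)
Lemma cusp_set_coord0 s x : cusp (set_coord 0 s x) = set_coord 0 s (cusp x).
Proof. by apply: vec3P; rewrite !mxE. Qed.

Lemma derive_coord n (i : 'I_n) (v x : 'rV[R]_n) :
  'D_v (fun y : 'rV[R]_n => y 0 i) x = v 0 i.
Proof.
by rewrite -derive_row ?derive_id //; exact/smooth_near_differentiable/smooth_near_rV_id.
Qed.

Lemma straighten_first (G : 'rV[R]_3 -> 'rV[R]_3) : map_germ G ->
  [/\ 0 < ('D_(delta_mx 0 0) G 0) 0 0, ('D_(delta_mx 0 0) G 0) 0 1 = 0,
      0 < ('D_(delta_mx 0 1) G 0) 0 1 &
      [/\ ('D_(delta_mx 0 0) G 0) 0 2%:R = 0,
          ('D_(delta_mx 0 1) G 0) 0 2%:R = 0 &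
          ('D_(delta_mx 0 2%:R) G 0) 0 2%:R != 0]] ->
  exists (phi : 'rV[R]_2 -> 'rV[R]_2) (B C : 'rV[R]_3 -> R),
   [/\ diffeo_germ phi, smooth_near 0 B /\ smooth_near 0 C,
      [/\ B 0 = 0, 'D_(delta_mx 0 0) B 0 = 0 & 0 < 'D_(delta_mx 0 1) B 0],
      [/\ C 0 = 0, 'D_(delta_mx 0 0) C 0 = 0, 'D_(delta_mx 0 1) C 0 = 0 &
          'D_(delta_mx 0 2%:R) C 0 != 0] &
      \forall x \near (0 : 'rV[R]_2),
        G (cusp (phi x)) = vec3 (x 0 0) (B (cusp x)) (C (cusp x))].
Proof.
move=> [G0 sG]; have sGj := (smooth_near_rowP 0 G).2 sG.
have dG := smooth_near_differentiable sG.
have E k j := derive_row (delta_mx 0 k) j dG.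
move=> [A0 B0 B1 [C0 C1 C2]].
rewrite (E 0 0) in A0; rewrite (E 0 1) in B0; rewrite (E 1 1) in B1.
rewrite (E 0 2%:R) in C0; rewrite (E 1 2%:R) in C1; rewrite (E 2%:R 2%:R) in C2.
have [a [sa a0 Aa aA]] : exists a : 'rV[R]_3 -> R,
    [/\ smooth_near 0 a, a 0 = 0,
        \forall x \near (0 : 'rV[R]_3), G (set_coord 0 (a x) x) 0 0 = x 0 0 &
        \forall x \near (0 : 'rV[R]_3), a (set_coord 0 (G x 0 0) x) = x 0 0].
  by apply: implicit_function => //; rewrite G0 mxE.
pose psi x := set_coord 0 (a x) x.
have spsi : smooth_near 0 psi by apply: smooth_near_set_coord => //; exact: smooth_near_rV_id.
have psi0 : psi 0 = 0 by rewrite /psi a0 set_coord0.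
have sGpsi j : smooth_near 0 (fun x => G (psi x) 0 j).
  by apply: (smooth_near_comp (f := fun y => G y 0 j)) => //; rewrite psi0.
have Dpsi j k : j != 0 -> 'D_(delta_mx 0 k) (fun x => psi x 0 j) 0 = (j == k)%:R.
  move=> /negbTE j0; have -> : (fun x => psi x 0 j) = (fun x => x 0 j).
    by apply/funext => x; rewrite set_coordE j0.
  by rewrite derive_coord mxE eqxx.
(* For the second and third components the first summand vanishes at 0 by the choice of frame, so
   the substitution leaves the needed derivatives unchanged. *)
have DGpsi j k : 'D_(delta_mx 0 k) (fun x => G (psi x) 0 j) 0 =
    'D_(delta_mx 0 k) (fun x => psi x 0 0) 0 * 'D_(delta_mx 0 0) (fun x => G x 0 j) 0 +
    (1 == k)%:R * 'D_(delta_mx 0 1) (fun x => G x 0 j) 0 +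
    (2%:R == k)%:R * 'D_(delta_mx 0 2%:R) (fun x => G x 0 j) 0.
  rewrite (derive_comp_row (f := fun y => G y 0 j)) ?psi0; last 2 first.
  - exact: smooth_near_differentiable.
  - exact: smooth_near_differentiable.
  by rewrite sum3E (Dpsi 1) // (Dpsi 2%:R).
exists (fun x => set_coord 0 (a (cusp x)) x), (fun x => G (psi x) 0 1), (fun x => G (psi x) 0 2%:R).
have scusp := smooth_near_cusp.
split.
- apply: (@diffeo_germ_set_coord _ _ _ (fun x => a (cusp x)) (fun x => G (cusp x) 0 0)).
  + by apply: smooth_near_comp => //; rewrite cusp_at0.
  + by apply: (smooth_near_comp (f := fun y => G y 0 0)); rewrite ?cusp_at0.
  + by rewrite cusp_at0.
  + by rewrite cusp_at0 G0 mxE.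
  + rewrite -cusp_at0 in aA; apply: filterS (smooth_near_near scusp aA) => x.
    by rewrite cusp_set_coord0 => ->; rewrite vec3E.
  + rewrite -cusp_at0 in Aa; apply: filterS (smooth_near_near scusp Aa) => x.
    by rewrite cusp_set_coord0 => ->; rewrite vec3E.
- by split.
- by split; rewrite ?psi0 ?G0 ?mxE // !DGpsi B0 mulr0 add0r !mul0r ?addr0 ?mul1r.
- by split; rewrite ?psi0 ?G0 ?mxE // !DGpsi C0 C1 !mulr0 ?add0r ?mul0r ?mul1r ?addr0.
- rewrite -cusp_at0 in Aa; apply: filterS (smooth_near_near scusp Aa) => x Ax.
  rewrite cusp_set_coord0; apply: vec3P; rewrite ?vec3E //.
  by rewrite Ax vec3E.
Qed.

(* The new coordinate is V = v * sqrt (2 q), where the second component is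
   B (u, 0, 0) + v^2 q (u, v), and v = b (u, V) = V * w (u, V). *)
Lemma straighten_second (B : 'rV[R]_3 -> R) (P Q : 'rV[R]_3 -> R) :
  smooth_near 0 P -> smooth_near 0 Q -> 0 < P 0 ->
  (\forall x \near (0 : 'rV[R]_2),
      B (cusp x) = B (vec3 (x 0 0) 0 0) + x 0 1 ^+ 2 * P (cusp x) +
            x 0 1 ^+ 3 * Q (vec3 (x 0 0) 0 (x 0 1 ^+ 3))) ->
  exists b w : 'rV[R]_2 -> R,
   [/\ smooth_near 0 b /\ b 0 = 0, diffeo_germ (fun x => set_coord 1 (b x) x),
    smooth_near 0 w /\ w 0 != 0,
    \forall x \near (0 : 'rV[R]_2), b x = x 0 1 * w x &
    \forall x \near (0 : 'rV[R]_2),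
      B (cusp (set_coord 1 (b x) x)) = B (vec3 (x 0 0) 0 0) + 1 / 2 * x 0 1 ^+ 2].
Proof.
move=> sP sQ P0 BE.
have scusp := smooth_near_cusp.
have scoord i := @smooth_near_coord R 2 0 i.
pose q (x : 'rV[R]_2) := P (cusp x) + x 0 1 * Q (vec3 (x 0 0) 0 (x 0 1 ^+ 3)).
have sq : smooth_near 0 q.
  apply: smooth_nearD; first by apply: smooth_near_comp => //; rewrite cusp_at0.
  apply: smooth_nearM => //; apply: smooth_near_comp_vec3 => //; rewrite ?mxE ?expr0n //.
    exact: smooth_near_cst.
  exact: smooth_nearX.
have q0 : 0 < q 0 by rewrite /q cusp_at0 mxE mul0r addr0.
(* The factor 2 turns v^2 q into V^2 / 2, the coefficient required in the normal form. *)
pose r x := Num.sqrt (2 * q x).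
have s2q : smooth_near 0 (fun x => 2 * q x) by apply: smooth_nearM => //; exact: smooth_near_cst.
have sr : smooth_near 0 r by apply: smooth_near_sqrt => //; rewrite mulr_gt0.
have r0 : 0 < r 0 by rewrite sqrtr_gt0 mulr_gt0.
pose F (x : 'rV[R]_2) := x 0 1 * r x.
have sF : smooth_near 0 F by exact: smooth_nearM.
have F0 : F 0 = 0 by rewrite /F mxE mul0r.
have DF : 0 < 'D_(delta_mx 0 1) F 0.
  rewrite deriveM; last 2 first.
  - exact/diff_derivable/smooth_near_differentiable.
  - exact/diff_derivable/smooth_near_differentiable.
  by rewrite derive_coord !mxE scale0r add0r /= [_ *: _]mulr1.
have [b [sb b0 Fb bF]] := implicit_function sF F0 DF.
pose phi x := set_coord 1 (b x) x.
have sphi : smooth_near 0 phi by apply: smooth_near_set_coord => //; exact: smooth_near_rV_id.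
have phi0 : phi 0 = 0 by rewrite /phi b0 set_coord0.
have srphi : smooth_near 0 (fun x => r (phi x)).
  by apply: (smooth_near_comp (f := r)) => //; rewrite phi0.
have rpos : \forall x \near (0 : 'rV[R]_2), 0 < r (phi x).
  have r0' : 0 < r (phi 0) by rewrite phi0.
  exact: (smooth_near_near srphi (open_nbhs_nbhs (conj (@open_gt R 0) r0'))).
(* [F (phi x)] is [b x * r (phi x)] and equals [x 0 1], which gives [w]. *)
exists b, (fun x => (r (phi x))^-1); split=> //.
- exact: (@diffeo_germ_set_coord _ _ _ b F).
- by split; [apply: smooth_nearV => //|rewrite invr_eq0]; rewrite phi0 gt_eqF.
- apply: filterS2 rpos Fb => x rx; rewrite /F -/(phi x) set_coordE eqxx => <-.
  by rewrite mulfK // gt_eqF.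
rewrite -phi0 in BE.
apply: filterS3 rpos Fb (smooth_near_near sphi BE) => x rx Fx ->.
have bE : phi x 0 1 = b x by rewrite set_coordE.
have uE : phi x 0 0 = x 0 0 by rewrite set_coordE.
rewrite -addrA uE; congr (_ + _).
have <- : F (phi x) = x 0 1 by [].
rewrite /F exprMn sqr_sqrtr; last by rewrite ltW // -sqrtr_gt0.
by rewrite /q uE bE; field.
Qed.

End main.

(** * The third component in the normalized coordinates *)

Section third.
Variable R : realType.
Local Notation cusp := (@standard_cuspidal_edge R).

Lemma linear_expansion (f : R -> R) : smooth_near 0 f -> f 0 = 0 ->
  exists (c : R) (h : R -> R), smooth_near 0 h /\
    \forall u \near (0 : R), f u = c * u + u ^+ 2 * h u.
Proof.
move=> sf f0; have [q sq fq] := Hadamard1 sf; have [h sh qh] := Hadamard1 sq.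
exists (q 0), h; split=> //; near=> u.
have -> : f u = f 0 + u * q u by near: u.
have -> : q u = q 0 + u * h u by near: u.
by rewrite f0; ring.
Unshelve. all: by end_near.
Qed.

Lemma near_coord n (i : 'I_n) (Z : set R) : (\forall u \near (0 : R), Z u) ->
  \forall x \near (0 : 'rV[R]_n), Z ((x : 'rV[R]_n) 0 i).
Proof. by move=> Z0; apply: (smooth_near_near (smooth_near_coord 0 i)); rewrite mxE. Qed.

(** Substituting v = V w into C (u, 0, 0) + v^2 P + v^3 Q, the coefficient of V^2 must be made to
    depend on u alone; whatever depends on V is moved into the coefficient [K1] of V^3. Then [k0] is
    expanded in u, and [K1] in V and then in u. *)
Lemma third_component (C : 'rV[R]_3 -> R) (b w : 'rV[R]_2 -> R) :
  smooth_near 0 C -> C 0 = 0 -> 'D_(delta_mx 0 0) C 0 = 0 ->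
  'D_(delta_mx 0 1) C 0 = 0 -> 'D_(delta_mx 0 2%:R) C 0 != 0 ->
  smooth_near 0 b -> b 0 = 0 -> smooth_near 0 w -> w 0 != 0 ->
  (\forall x \near (0 : 'rV[R]_2), b x = x 0 1 * w x) ->
  exists (b20 b30 b12 b03 : R) (h2 h3 h4 : R -> R) (h5 : 'rV[R]_2 -> R),
    [/\ b03 != 0, smooth_near 0 h2, smooth_near 0 h3, smooth_near 0 h4 &
     smooth_near 0 h5 /\
     \forall x \near (0 : 'rV[R]_2),
       C (cusp (set_coord 1 (b x) x)) =
        b20 / 2 * x 0 0 ^+ 2 + b30 / 6 * x 0 0 ^+ 3
        + b12 / 2 * (x 0 0 * x 0 1 ^+ 2) + b03 / 6 * x 0 1 ^+ 3
        + (x 0 0 ^+ 4 * h2 (x 0 0) + x 0 0 ^+ 2 * x 0 1 ^+ 2 * h3 (x 0 0)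
        + x 0 0 * x 0 1 ^+ 3 * h4 (x 0 0) + x 0 1 ^+ 4 * h5 x)].
Proof.
move=> sC C0 DC0 DC1 DC2 sb b0 sw w0 bw.
have scusp := @smooth_near_cusp R.
have scoord i := @smooth_near_coord R 2 0 i.
pose phi x := set_coord 1 (b x) x.
have sphi : smooth_near 0 phi by apply: smooth_near_set_coord => //; exact: smooth_near_rV_id.
have phi0 : phi 0 = 0 by rewrite /phi b0 set_coord0.
have scphi : smooth_near 0 (fun x => cusp (phi x)).
  by apply: (smooth_near_comp_row (f := cusp)); rewrite ?phi0.
have scphi' : smooth_near 0 (fun x => vec3 (phi x 0 0) 0 (phi x 0 1 ^+ 3)).
  move/smooth_near_rowP : sphi => sphi; apply: smooth_near_vec3 => //.
    exact: smooth_near_cst.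
  exact: smooth_nearX.
have vphi0 : vec3 (phi 0 0 0) 0 (phi 0 0 1 ^+ 3) = 0 by rewrite phi0 !mxE expr0n vec3_0.
have [c20 [c30 [h2 [sh2 Ch2]]]] := axis_expansion sC C0 DC0.
have [P [Q [sP sQ P0 Q0 CE]]] := cuspidal_expansion sC.
(* Expanding [P] once more writes it on the cusp as [p0 u] plus v times [E], with [E] vanishing at
   0. *)
have [P4 [P5 [sP4 sP5 _ _ PE]]] := cuspidal_expansion sP.
have [W [sW _ WE]] : exists W : 'rV[R]_2 -> R, [/\ smooth_near 0 W,
    W 0 = 'D_(delta_mx 0 1) (fun x => w x ^+ 2) 0 &
        \forall x \near (0 : 'rV[R]_2),
          w x ^+ 2 = w (set_coord 1 0 x) ^+ 2 + x 0 1 * W x].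
  by apply: (Hadamard 1 (F := fun x => w x ^+ 2)); exact: smooth_nearX.
pose E x := b x * P4 (cusp (phi x)) + b x ^+ 2 * P5 (vec3 (phi x 0 0) 0 (phi x 0 1 ^+ 3)).
have sE : smooth_near 0 E.
  apply: smooth_nearD; apply: smooth_nearM => //; try exact: smooth_nearX.
  - by apply: (smooth_near_comp (f := P4)) => //; rewrite phi0 cusp_at0.
  - by apply: (smooth_near_comp (f := P5)) => //; rewrite vphi0.
have E0 : E 0 = 0 by rewrite /E b0 expr0n !mul0r addr0.
pose Qx x := Q (vec3 (phi x 0 0) 0 (phi x 0 1 ^+ 3)).
have sQx : smooth_near 0 Qx by apply: (smooth_near_comp (f := Q)) => //; rewrite vphi0.
pose p0 u := P (vec3 u 0 0).
have sp0 : smooth_near 0 p0.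
  apply: smooth_near_comp_vec3 => //; try exact: smooth_near_cst.
  exact: smooth_near_id.
have p00 : p0 0 = 0 by rewrite /p0 vec3_0 P0.
(* The terms of order V^3: [W] comes from w^2 = w (u, 0)^2 + V W, and w^3 from v^3. At 0 only w^3
   times dC/dz remains, since [p0] and [E] vanish there. *)
pose K1 (x : 'rV[R]_2) := W x * p0 (x 0 0) + w x ^+ 3 * (E x + Qx x).
have sK1 : smooth_near 0 K1.
  apply: smooth_nearD; apply: smooth_nearM => //.
  - by apply: smooth_near_comp1 => //; rewrite mxE.
  - exact: smooth_nearX.
  - exact: smooth_nearD.
have K10 : K1 0 != 0.
  by rewrite /K1 mxE p00 mulr0 add0r E0 add0r mulf_neq0 ?expf_neq0 // /Qx vphi0 Q0.
have [h5 [sh5 _ K1E]] := Hadamard 1 sK1.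
have saxis : smooth_near 0 (fun u : R => vec2 u 0).
  by apply: smooth_near_vec2; [exact: smooth_near_id|exact: smooth_near_cst].
(* The coefficient of V^2, a function of u alone; it vanishes at 0 because [p0 0] is dC/dy at 0. *)
pose k0 u := w (vec2 u 0) ^+ 2 * p0 u.
have sk0 : smooth_near 0 k0.
  apply: smooth_nearM => //; apply: smooth_nearX.
  by apply: (smooth_near_comp (f := w)) => //; rewrite vec2_0.
have [c12 [h3 [sh3 k0E]]] : exists (c : R) (h : R -> R), smooth_near 0 h /\
    \forall u \near (0 : R), k0 u = c * u + u ^+ 2 * h u.
  by apply: linear_expansion; rewrite // /k0 p00 mulr0.
have sk1 : smooth_near 0 (fun u => K1 (vec2 u 0)).
  by apply: (smooth_near_comp (f := K1)) => //; rewrite vec2_0.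
have [h4 sh4 k1E] := Hadamard1 sk1.
(* The factors 2 and 6 compensate the denominators of the normal form. *)
exists c20, c30, (2 * c12), (6 * K1 0), h2, h3, h4, h5; split=> //.
  by rewrite mulf_neq0 // pnatr_eq0.
split=> //.
have axisE (x : 'rV[R]_2) : set_coord 1 0 x = vec2 (x 0 0) 0.
  by apply/rowP; apply: ord2_ind; rewrite !mxE.
have phiE x : phi x 0 0 = x 0 0 by rewrite set_coordE.
have phiE1 x : phi x 0 1 = b x by rewrite set_coordE.
rewrite -phi0 in CE PE.
near=> x.
have -> : C (cusp (phi x)) = C (vec3 (phi x 0 0) 0 0) +
     phi x 0 1 ^+ 2 * P (cusp (phi x)) + phi x 0 1 ^+ 3 * Qx x.
  by near: x; exact: (smooth_near_near sphi CE).
have -> : P (cusp (phi x)) = p0 (phi x 0 0) + phi x 0 1 * E x.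
  have -> : P (cusp (phi x)) = p0 (phi x 0 0) + phi x 0 1 ^+ 2 * P4 (cusp (phi x)) +
      phi x 0 1 ^+ 3 * P5 (vec3 (phi x 0 0) 0 (phi x 0 1 ^+ 3)).
    by near: x; exact: (smooth_near_near sphi PE).
  by rewrite /E !phiE1; ring.
rewrite phiE phiE1.
have -> : C (vec3 (x 0 0) 0 0) =
    c20 / 2 * x 0 0 ^+ 2 + c30 / 6 * x 0 0 ^+ 3 + x 0 0 ^+ 4 * h2 (x 0 0).
  by near: x; exact: near_coord Ch2.
have bx : b x = x 0 1 * w x by near: x.
have wx : w x ^+ 2 = w (vec2 (x 0 0) 0) ^+ 2 + x 0 1 * W x.
  by rewrite -axisE; near: x.
have K1x : K1 x = K1 (vec2 (x 0 0) 0) + x 0 1 * h5 x.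
  by rewrite -axisE; near: x.
have k1x : K1 (vec2 (x 0 0) 0) = K1 0 + x 0 0 * h4 (x 0 0).
  by rewrite -[in K1 0]vec2_0; near: x; exact: (near_coord 0 k1E).
have k0x : k0 (x 0 0) = c12 * x 0 0 + x 0 0 ^+ 2 * h3 (x 0 0).
  by near: x; exact: near_coord k0E.
have mid : b x ^+ 2 * (p0 (x 0 0) + b x * E x) + b x ^+ 3 * Qx x =
    x 0 1 ^+ 2 * k0 (x 0 0) + x 0 1 ^+ 3 * K1 x.
  have -> : b x ^+ 2 * (p0 (x 0 0) + b x * E x) + b x ^+ 3 * Qx x =
      x 0 1 ^+ 2 * (w x ^+ 2 * p0 (x 0 0)) + x 0 1 ^+ 3 * (w x ^+ 3 * (E x + Qx x)).
    by rewrite bx; ring.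
  by rewrite wx /k0 /K1; ring.
rewrite -addrA mid k0x K1x k1x; field.
Unshelve. all: by end_near.
Qed.

Lemma isometry_germ_flip : isometry_germ (fun y : 'rV[R]_3 => vec3 (y 0 0) (y 0 1) (- y 0 2%:R)).
Proof.
split; last by rewrite !mxE oppr0 vec3_0.
split.
  by exists (fun y : 'rV[R]_3 => vec3 (y 0 0) (y 0 1) (- y 0 2%:R)) => y;
    apply: vec3P; rewrite !vec3E ?opprK.
by move=> x y; rewrite /euclidean_dist !sum3E !vec3E; congr Num.sqrt; ring.
Qed.

End third.

Theorem theorem3p1 (R : realType) (f : 'rV[R]_2 -> 'rV[R]_3) :
  map_germ f -> cuspidal_edge_at0 f ->
  exists (phi : 'rV[R]_2 -> 'rV[R]_2) (Phi : 'rV[R]_3 -> 'rV[R]_3)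
         (a20 a30 b20 b30 b12 b03 : R)
         (h1 h2 h3 h4 : R -> R) (h5 : 'rV[R]_2 -> R),
    diffeo_germ phi /\ isometry_germ Phi /\
    b03 != 0 /\ 0 <= b20 /\
    smooth_near 0 h1 /\ smooth_near 0 h2 /\ smooth_near 0 h3 /\
    smooth_near 0 h4 /\ smooth_near 0 h5 /\
    \forall x \near (0 : 'rV[R]_2),
      let u : R := (x : 'rV[R]_2) 0 0 in
      let v : R := (x : 'rV[R]_2) 0 1 in
      Phi (f (phi x)) =
        vec3 u
             (a20 / 2 * u ^+ 2 + a30 / 6 * u ^+ 3 + 1 / 2 * v ^+ 2)
             (b20 / 2 * u ^+ 2 + b30 / 6 * u ^+ 3 + b12 / 2 * (u * v ^+ 2)
              + b03 / 6 * v ^+ 3)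
        + vec3 0
               (u ^+ 4 * h1 u)
               (u ^+ 4 * h2 u + u ^+ 2 * v ^+ 2 * h3 u + u * v ^+ 3 * h4 u
                + v ^+ 4 * h5 x).
Proof.
move=> mf [_ fcusp].
have [sigma [Phi [G [dsigma iPhi mG PhiG DG]]]] := cuspidal_edge_frame mf fcusp.
have [phi [B [C [dphi [sB sC] [B0 DB0 DB1] [C0 DC0 DC1 DC2] GE]]]] := straighten_first mG DG.
have [P [Q [sP sQ P0 _ BE]]] := cuspidal_expansion sB.
have [b [w [[sb b0] db [sw w0] bw Bb]]] : exists b w : 'rV[R]_2 -> R,
   [/\ smooth_near 0 b /\ b 0 = 0, diffeo_germ (fun x => set_coord 1 (b x) x),
    smooth_near 0 w /\ w 0 != 0,
    \forall x \near (0 : 'rV[R]_2), b x = x 0 1 * w x &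
    \forall x \near (0 : 'rV[R]_2),
      B (standard_cuspidal_edge (set_coord 1 (b x) x)) =
      B (vec3 (x 0 0) 0 0) + 1 / 2 * x 0 1 ^+ 2].
  by apply: straighten_second BE; rewrite // P0.
have [a20 [a30 [h1 [sh1 Bh1]]]] := axis_expansion sB B0 DB0.
have [b20 [b30 [b12 [b03 [h2 [h3 [h4 [h5 [b03_neq0 sh2 sh3 sh4 [sh5 CE]]]]]]]]]] :=
  third_component sC C0 DC0 DC1 DC2 sb b0 sw w0 bw.
pose psi x := phi (set_coord 1 (b x) x).
have dpsi : diffeo_germ psi by exact: diffeo_germ_comp.
have dspsi : diffeo_germ (fun x => sigma (psi x)) by exact: diffeo_germ_comp.
have Bh1' : \forall x \near (0 : 'rV[R]_2),
    B (vec3 ((x : 'rV[R]_2) 0 0) 0 0) =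
    a20 / 2 * x 0 0 ^+ 2 + a30 / 6 * x 0 0 ^+ 3 + x 0 0 ^+ 4 * h1 (x 0 0).
  exact: (near_coord 0 Bh1).
have E1 := map_germ_continuous dpsi.1 PhiG.
have E2 := map_germ_continuous db.1 GE.
have E : \forall x \near (0 : 'rV[R]_2), Phi (f (sigma (psi x))) =
    vec3 (x 0 0)
      (a20 / 2 * x 0 0 ^+ 2 + a30 / 6 * x 0 0 ^+ 3 + 1 / 2 * x 0 1 ^+ 2 + x 0 0 ^+ 4 * h1 (x 0 0))
      (b20 / 2 * x 0 0 ^+ 2 + b30 / 6 * x 0 0 ^+ 3
        + b12 / 2 * (x 0 0 * x 0 1 ^+ 2) + b03 / 6 * x 0 1 ^+ 3
        + (x 0 0 ^+ 4 * h2 (x 0 0) + x 0 0 ^+ 2 * x 0 1 ^+ 2 * h3 (x 0 0)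
        + x 0 0 * x 0 1 ^+ 3 * h4 (x 0 0) + x 0 1 ^+ 4 * h5 x)).
  near=> x.
  have -> : Phi (f (sigma (psi x))) = G (standard_cuspidal_edge (psi x)) by near: x.
  have -> : G (standard_cuspidal_edge (psi x)) =
      vec3 (set_coord 1 (b x) x 0 0) (B (standard_cuspidal_edge (set_coord 1 (b x) x)))
        (C (standard_cuspidal_edge (set_coord 1 (b x) x))) by near: x.
  (* The second change of coordinates fixes index 0, so the first component remains u. *)
  rewrite set_coordE /=; congr vec3; last by near: x.
  rewrite (_ : B _ = B (vec3 (x 0 0) 0 0) + 1 / 2 * x 0 1 ^+ 2); last by near: x.
  rewrite (_ : B _ = a20 / 2 * x 0 0 ^+ 2 + a30 / 6 * x 0 0 ^+ 3 + x 0 0 ^+ 4 * h1 (x 0 0)).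
    by rewrite addrAC.
  by near: x.
have [b20_ge0|b20_lt0] := leP 0 b20.
  exists (fun x => sigma (psi x)), Phi, a20, a30, b20, b30, b12, b03, h1, h2, h3, h4, h5.
  do ![split=> //]; apply: filterS E => x /= ->.
  by apply: vec3P; rewrite [in RHS]mxE !vec3E ?addr0.
(* The reflection leaves the first two components alone and changes the sign of every coefficient
   and remainder of the third, so [b03] stays nonzero. *)
exists (fun x => sigma (psi x)), ((fun y : 'rV[R]_3 => vec3 (y 0 0) (y 0 1) (- y 0 2%:R)) \o Phi).
exists a20, a30, (- b20), (- b30), (- b12), (- b03), h1.
exists (fun u => - h2 u), (fun u => - h3 u), (fun u => - h4 u), (fun x => - h5 x).
split; first by [].
split; first by apply: isometry_germ_comp => //; exact: isometry_germ_flip.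
split; first by rewrite oppr_eq0.
split; first by rewrite oppr_ge0 ltW.
split; first by [].
do 4?[split; first exact: smooth_nearN].
apply: filterS E => x /= ->.
by apply: vec3P; rewrite [in RHS]mxE !vec3E ?addr0 //; ring.
Unshelve. all: by end_near.
Qed.
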